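(* Let $u_h\in U_{i,h}$ and $\alpha_{i-1,h}\in A_h$ be given, and let $K_{i,h}=\{\beta_h\in A_h:\alpha_{i-1,h}\le\beta_h\}$. Then the problem of finding $\alpha_h\in K_{i,h}$ such that $$\mathcal{A}_h(u_h;\alpha_h,\beta_h-\alpha_h)\ge f(u_h;\beta_h-\alpha_h)\quad\forall\beta_h\in K_{i,h}$$ admits a unique solution.
   Context: **Setting.** $\Omega\subset\mathbb{R}^d$ ($d=2,3$) is a bounded polyhedral domain which can be perfectly fitted by simplicial meshes. Its boundary is partitioned as $\partial\Omega=\partial\Omega_D\cup\partial\Omega_N$ with $\partial\Omega_D$ closed and of positive $(d-1)$-dimensional measure, and $\partial\Omega_N$ open in $\partial\Omega$. $\mathbb{C}=\lambda\mathbf{1}\otimes\mathbf{1}+2\mu\mathbf{1}_4$ is the isotropic Hooke tensor with Lamé coefficients $\lambda,\mu$ ($\mathbf 1$, $\mathbf 1_4$ the unit tensors of orders 2 and 4), positive definite on symmetric matrices. The constants $\ell>0$ and $G_c>0$ are fixed, and $c_w=4\int_0^1\sqrt{w(s)}\,ds$ with $w(s)=s$. The Dirichlet datum is $w_i\in(H^{1/2}(\partial\Omega))^d$, and $f_i\in(H^1(\Omega))^d$ is a fixed function with $f_i=w_i$ on $\partial\Omega_D$. **Mesh and spaces.** $\mathcal{T}_h$ is a matching simplicial mesh of $\Omega$ and $\mathcal{F}_h^i$ is the set of its internal facets. $[\cdot]_F$ is the jump across $F$ (difference of the restrictions to the two cells sharing $F$). $\nabla_h$ is the broken (cellwise) gradient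 and $\mathrm{e}_h$ its symmetric part. $\mathbb{P}^1(\mathcal{T}_h)$ and $\mathbb{P}^1_d(\mathcal{T}_h)$ are the spaces of discontinuous, cellwise affine functions with values in $\mathbb{R}$ and $\mathbb{R}^d$ respectively, and $\pi_h$ is the $L^2$-orthogonal projection onto $\mathbb{P}^1_d(\mathcal{T}_h)$. Then $U_{i,h}=\{u_h\in\mathbb{P}^1_d(\mathcal{T}_h): u_h=\pi_hf_i\text{ on }\partial\Omega_D\}$, $A_h=\{\alpha_h\in\mathbb{P}^1(\mathcal{T}_h):\int_F[\alpha_h]_F\,dS=0\ \forall F\in\mathcal{F}_h^i,\ \alpha_h=0\text{ on }\partial\Omega_D\}$ (Crouzeix–Raviart space). **Forms.** For $\alpha_h,\beta_h\in A_h$, $$\mathcal{A}_h(u_h;\alpha_h,\beta_h)=\int_\Omega\mathbb{C}\mathrm{e}_h(u_h)\cdot\mathrm{e}_h(u_h)\,\alpha_h\beta_h\,dx+\frac{2G_c}{c_w}\int_\Omega\ell\,\nabla_h\alpha_h\cdot\nabla_h\beta_h\,dx,$$ $$f(u_h;\beta_h)=\int_\Omega\mathbb{C}\mathrm{e}_h(u_h)\cdot\mathrm{e}_h(u_h)\,\beta_h\,dx-\frac{G_c}{c_w}\int_\Omega\frac{\beta_h}{\ell}\,dx.$$ *)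

(* Defs.v *)
From HB Require Import structures.
From mathcomp Require Import all_boot all_order all_algebra.
From mathcomp Require Import all_classical all_reals all_analysis.
From mathcomp Require Import measurable_realfun.
Set Implicit Arguments.
Unset Strict Implicit.
Unset Printing Implicit Defensive.
Import Order.TTheory GRing.Theory Num.Theory.
Import numFieldNormedType.Exports.
Local Open Scope classical_set_scope.
Local Open Scope ring_scope.

(* 'rV[R]_m carries the product sigma-algebra, i.e. the Borel sets. *)

Section measurable_rV.
Variables (R : realType) (m : nat).

Definition coord (i : 'I_m) (x : 'rV[R]_m) : measurableTypeR R := x ord0 i.

Let rV_set0 : g_sigma_preimage coord set0.
Proof. exact: sigma_algebra0. Qed.

Let rV_setC A : g_sigma_preimage coord A -> g_sigma_preimage coord (~` A).
Proof. exact: sigma_algebraC. Qed.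

Let rV_bigcup (F : (set 'rV[R]_m)^nat) :
  (forall i, g_sigma_preimage coord (F i)) ->
  g_sigma_preimage coord (\bigcup_i (F i)).
Proof. exact: sigma_algebra_bigcup. Qed.

HB.instance Definition _ := @isMeasurable.Build default_measure_display
  'rV[R]_m (g_sigma_preimage coord) rV_set0 rV_setC rV_bigcup.

End measurable_rV.

Lemma measurable_coord (R : realType) m (i : 'I_m) :
  measurable_fun [set: 'rV[R]_m] (coord i).
Proof.
move=> _ Y mY; rewrite setTI; apply: sub_sigma_algebra => /=.
rewrite -bigcup_seq/=; exists i => /=; first by rewrite mem_index_enum.
by exists Y => //; rewrite setTI.
Qed.

Lemma measurable_fun_rV (R : realType) m d (T : measurableType d)
    (f : T -> 'rV[R]_m) :
  (forall i, measurable_fun [set: T] (coord i \o f)) ->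
  measurable_fun [set: T] f.
Proof.
move=> mf _ A mA; rewrite setTI.
have sub : <<s \big[setU/set0]_(i < m)
      preimage_set_system setT (@coord R m i) measurable >> `<=`
    [set B | measurable (f @^-1` B)].
  apply: smallest_sub.
    split => /=.
    - by rewrite preimage_set0; exact: measurable0.
    - by move=> B mB; rewrite setTD preimage_setC; exact: measurableC.
    - by move=> F mF; rewrite preimage_bigcup; exact: bigcupT_measurable.
  rewrite -bigcup_seq => B [i _ [C mC <-]] /=; rewrite setTI.
  by have := mf i measurableT C mC; rewrite setTI.
exact: sub mA.
Qed.

Lemma sigma_finite_prod d1 d2 (T1 : measurableType d1)
    (T2 : measurableType d2) (R : realType)
    (m1 : {sigma_finite_measure set T1 -> \bar R})
    (m2 : {sigma_finite_measure set T2 -> \bar R}) :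
  sigma_finite setT (m1 \x m2)%E.
Proof.
have /sigma_finiteP[F [TF ndF Foo]] := sigma_finiteT m1.
have /sigma_finiteP[G [TG ndG Goo]] := sigma_finiteT m2.
exists (fun n => F n `*` G n).
  rewrite -setXTT TF TG predeqE => -[x y]; split.
    move=> [/= [n _ Fnx] [k _ Gky]]; exists (maxn n k) => //; split.
    - by move: x Fnx; exact/subsetPset/ndF/leq_maxl.
    - by move: y Gky; exact/subsetPset/ndG/leq_maxr.
  by move=> [n _ []/= ? ?]; split; exists n.
move=> k; have [? ?] := Foo k; have [? ?] := Goo k.
split; first exact: measurableX.
by rewrite product_measure1E// lte_mul_pinfty// ge0_fin_numE.
Qed.

Section lebesgue_rV.
Variable R : realType.

Definition consrV m (p : measurableTypeR R * 'rV[R]_m) : 'rV[R]_m.+1 :=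
  \row_i (if unlift ord0 i is Some j then p.2 ord0 j else p.1).

Definition unconsrV m (x : 'rV[R]_m.+1) : measurableTypeR R * 'rV[R]_m :=
  (x ord0 ord0, \row_j x ord0 (lift ord0 j)).

Lemma measurable_consrV m : measurable_fun setT (@consrV m).
Proof.
apply: measurable_fun_rV => i.
have -> : coord i \o @consrV m = fun p =>
    if unlift ord0 i is Some j then coord j p.2 else p.1.
  by apply/funext => p; rewrite /= /coord mxE; case: unlift.
case: unlift => [j|]; last exact: measurable_fst.
by apply: measurableT_comp; [exact: measurable_coord | exact: measurable_snd].
Qed.

Lemma measurable_unconsrV m : measurable_fun setT (@unconsrV m).
Proof.
apply/measurable_fun_pairP; split; first exact: (@measurable_coord R m.+1 ord0).
apply: measurable_fun_rV => i.
rewrite (_ : _ \o _ = coord (lift ord0 i)); first exact: measurable_coord.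
by apply/funext => x; rewrite /= /coord mxE.
Qed.

Section step.
Variables (m : nat) (mu : {sigma_finite_measure set 'rV[R]_m -> \bar R}).

Definition lebesgue_step : set 'rV[R]_m.+1 -> \bar R :=
  pushforward (@lebesgue_measure R \x mu)%E (@consrV m).

Let pf : {measure set _ -> \bar R} :=
  measure_function_pushforward__canonical__measure_function_Measure
    (lebesgue_measure \x mu)%E (@measurable_consrV m).

HB.instance Definition _ := isMeasure.Build _ _ _ lebesgue_step
  (measure0 pf) (measure_ge0 pf) (@measure_semi_sigma_additive _ _ _ pf).

Let lebesgue_step_sigma_finite : sigma_finite setT lebesgue_step.
Proof.
have [F FT Foo] := sigma_finite_prod (@lebesgue_measure R) mu.
exists (fun k => @unconsrV m @^-1` F k).
  by rewrite -preimage_bigcup -FT preimage_setT.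
move=> k; have [mF Fk] := Foo k; split.
  by rewrite -[X in measurable X]setTI; exact: measurable_unconsrV.
rewrite /lebesgue_step /pushforward -comp_preimage.
rewrite (_ : _ \o _ = id)//; apply/funext => -[t v] /=.
rewrite /unconsrV /consrV mxE unlift_none; congr pair.
by apply/rowP => j; rewrite !mxE liftK.
Qed.

HB.instance Definition _ := Measure_isSigmaFinite.Build _ _ _
  lebesgue_step lebesgue_step_sigma_finite.

End step.

Fixpoint lebesgue_rV m : {sigma_finite_measure set 'rV[R]_m -> \bar R} :=
  if m is m'.+1 then lebesgue_step (lebesgue_rV m') else \d_(0 : 'rV[R]_0).

End lebesgue_rV.

Section simplices.
Variables (R : realType) (d : nat).
Notation V := 'rV[R]_d.

Definition dotrV (x y : V) : R := \sum_i x ord0 i * y ord0 i.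

(* The norm of the library on matrices is the sup norm. *)
Definition eucl_norm (x : V) : R := Num.sqrt (dotrV x x).

Definition unit_vec (i : 'I_d) : V := delta_mx ord0 i.

(* Convex hull of the vertices q j, j \in S. *)
Definition hull m (q : 'I_m -> V) (S : {set 'I_m}) : set V :=
  [set x | exists b : 'I_m -> R,
     [/\ forall j, 0 <= b j, forall j, j \notin S -> b j = 0,
         \sum_j b j = 1 & x = \sum_j b j *: q j]].

Definition edges m (q : 'I_m.+1 -> V) : 'M[R]_(m, d) :=
  \matrix_i (q (lift ord0 i) - q ord0).

Definition affinely_independent m (q : 'I_m.+1 -> V) := row_free (edges q).

Definition std_simplex m : set 'rV[R]_m :=
  [set t | (forall i, 0 <= t ord0 i) /\ \sum_i t ord0 i <= 1].

Definition simplex_param m (q : 'I_m.+1 -> V) (t : 'rV[R]_m) : V :=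
  q ord0 + t *m edges q.

Lemma measurable_std_simplex m : measurable (@std_simplex m).
Proof.
rewrite (_ : @std_simplex m = (\bigcap_(i in [set: 'I_m])
    (coord i @^-1` `[0, +oo[%classic)) `&`
    (fun t : 'rV[R]_m => \sum_i coord i t) @^-1` `]-oo, 1]%classic); last first.
  apply/seteqP; split => t /=.
    by move=> [t0 t1]; split; [move=> i _ /=; rewrite in_itv/= andbT; exact: t0
      | rewrite in_itv].
  move=> [t0]; rewrite in_itv/= => t1; split=> // i.
  by have := t0 i I; rewrite /= in_itv/= andbT.
apply: measurableI.
  apply: fin_bigcap_measurable => // i _; rewrite -[X in measurable X]setTI.
  by apply: measurable_coord => //; exact: measurable_itv.
rewrite -[X in measurable X]setTI.
by apply: measurable_sum => [i||]; [exact: measurable_coord | | exact: measurable_itv].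
Qed.

Lemma measurable_simplex_param m (q : 'I_m.+1 -> V) :
  measurable_fun setT (simplex_param q).
Proof.
apply: measurable_fun_rV => i.
rewrite (_ : _ \o _ = fun t : 'rV[R]_m =>
  q ord0 ord0 i + \sum_j coord j t * edges q j i); last first.
  by apply/funext => t; rewrite /= /coord !mxE.
apply: measurable_funD; first exact: measurable_cst.
apply: measurable_sum => j; apply: measurable_funM; last exact: measurable_cst.
exact: measurable_coord.
Qed.

(* The m-dimensional surface measure of the simplex with vertices q:
   \int_F g dS is the integral over the standard simplex of g o (simplex_param q)
   times the Gram factor sqrt (det (J J^T)), J = edges q. *)
Section simplex_measure.
Variables (m : nat) (q : 'I_m.+1 -> V).

Definition gram_factor : {nonneg R} :=
  NngNum (sqrtr_ge0 (\det (edges q *m (edges q)^T))).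

Definition simplex_measure (A : set V) : \bar R :=
  (gram_factor%:num%:E *
    lebesgue_rV R m (simplex_param q @^-1` A `&` @std_simplex m))%E.

Let sm : {measure set V -> \bar R} := mscale gram_factor
  (measure_function_pushforward__canonical__measure_function_Measure
    (mrestr (lebesgue_rV R m) (@measurable_std_simplex m))
    (@measurable_simplex_param m q)).

HB.instance Definition _ := isMeasure.Build _ _ _ simplex_measure
  (measure0 sm) (measure_ge0 sm) (@measure_semi_sigma_additive _ _ _ sm).

End simplex_measure.

Definition bnd (A : set V) : set V := closure A `\` interior A.

End simplices.

Section mesh.
Variables (R : realType) (n : nat).
(* The space dimension is d = n.+1. *)
Notation V := 'rV[R]_n.+1.

Record simplicial_mesh := SimplicialMesh {
  ncells : nat;
  vertex : 'I_ncells -> 'I_n.+2 -> V;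
  cell k := hull (vertex k) [set: _];
  vertex_indep : forall k, affinely_independent (vertex k);
  cell_inj : injective cell;
  (* Two cells meet along a common, possibly empty, face. *)
  matching : forall k l, k != l -> exists S S' : {set 'I_n.+2},
    cell k `&` cell l = hull (vertex k) S /\
    cell k `&` cell l = hull (vertex l) S' }.

Variable M : simplicial_mesh.

(* A pair (k, i) stands for the facet of the cell k opposite to its vertex i. *)
Definition facet_idx : Type := ('I_(ncells M) * 'I_n.+2)%type.

Definition facet (F : facet_idx) : set V := hull (vertex F.1) [set~ F.2].

Definition facet_measure (F : facet_idx) : set V -> \bar R :=
  simplex_measure (fun j : 'I_n.+1 => vertex F.1 (lift F.2 j)).
HB.instance Definition _ F := Measure.on (facet_measure F).

(* The last clause says that Omega lies locally on one side of its boundary. *)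
Definition polyhedral_domain (Omega : set V) : Prop :=
  [/\ open Omega, connected Omega, bounded_set Omega
    & Omega = interior (closure Omega)].

Definition fits (Omega : set V) : Prop :=
  closure Omega = \bigcup_(k in [set: 'I_(ncells M)]) cell k.

Definition boundary_facet (Omega : set V) (F : facet_idx) : Prop :=
  facet F `<=` bnd Omega.

Definition surface (Omega A : set V) : \bar R :=
  (\sum_(F : facet_idx | `[< boundary_facet Omega F >]) facet_measure F A)%E.

(* A function on the mesh is the family of its values on the cells.  The affine
   function attached to a cell is defined on the whole space. *)
Definition broken (T : Type) : Type := 'I_(ncells M) -> V -> T.

(* The integral over Omega of a function given cell by cell. *)
Definition broken_int (g : broken R) : R :=
  \sum_k \int[lebesgue_rV R n.+1]_(x in cell k) g k x.

End mesh.

Section sobolev.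
Variables (R : realType) (n : nat).
Notation V := 'rV[R]_n.+1.
Notation leb := (lebesgue_rV R n.+1).

Definition pderiv (i : 'I_n.+1) (f : V -> R) (x : V) : R :=
  'D_(unit_vec R i) f x.

Definition square_integrable (mu : {measure set V -> \bar R}) (D : set V)
    (f : V -> R) : Prop :=
  measurable_fun D f /\ (\int[mu]_(x in D) ((f x) ^+ 2)%:E < +oo)%E.

Fixpoint Ck (k : nat) (f : V -> R) : Prop :=
  continuous f /\
  if k is k'.+1 then
    (forall i x, derivable f x (unit_vec R i)) /\
    (forall i, Ck k' (pderiv i f))
  else True.

Definition smooth (f : V -> R) : Prop := forall k, Ck k f.

Definition test_function (Omega : set V) (phi : V -> R) : Prop :=
  smooth phi /\ exists K : set V,
    [/\ compact K, K `<=` Omega & forall x, ~ K x -> phi x = 0].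

Definition weak_pderiv (Omega : set V) (i : 'I_n.+1) (f g : V -> R) : Prop :=
  forall phi, test_function Omega phi ->
    \int[leb]_(x in Omega) (f x * pderiv i phi x) =
    - \int[leb]_(x in Omega) (g x * phi x).

Definition H1 (Omega : set V) (f : V -> R) : Prop :=
  square_integrable leb Omega f /\
  forall i, exists g, square_integrable leb Omega g /\ weak_pderiv Omega i f g.

Definition comp (f : V -> V) (i : 'I_n.+1) : V -> R := fun x => f x ord0 i.

Definition H1_vec (Omega : set V) (f : V -> V) : Prop :=
  forall i, H1 Omega (comp f i).

Variable M : simplicial_mesh R n.

(* w is the trace of f: the limit in L^2(bnd Omega) of the boundary values of
   functions smooth up to the boundary that converge to f in H^1(Omega). *)
Definition is_trace (Omega : set V) (f w : V -> R) : Prop :=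
  exists phi : nat -> V -> R,
  [/\ forall k, smooth (phi k),
      (fun k => \int[leb]_(x in Omega) ((phi k x - f x) ^+ 2)%:E)%E @ \oo
        --> 0%E,
      forall i g, square_integrable leb Omega g -> weak_pderiv Omega i f g ->
        (fun k => \int[leb]_(x in Omega) ((pderiv i (phi k) x - g x) ^+ 2)%:E)%E
          @ \oo --> 0%E
    & forall F : facet_idx M, boundary_facet Omega F ->
        square_integrable (facet_measure F) (facet F) w /\
        (fun k =>
          \int[facet_measure F]_(x in facet F) ((phi k x - w x) ^+ 2)%:E)%E
          @ \oo --> 0%E].

(* H^(1/2)(bnd Omega)^d through the Sobolev-Slobodeckij seminorm; the exponent of
   the kernel is (d - 1) + 2 * (1/2) = d = n.+1. *)
Definition H12_vec (Omega : set V) (w : V -> V) : Prop :=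
  (forall F : facet_idx M, boundary_facet Omega F ->
     forall i, square_integrable (facet_measure F) (facet F) (comp w i)) /\
  (forall F F' : facet_idx M, boundary_facet Omega F -> boundary_facet Omega F' ->
     (\int[facet_measure F]_(x in facet F) \int[facet_measure F']_(y in facet F')
        ((eucl_norm (w x - w y)) ^+ 2 / (eucl_norm (x - y)) ^+ n.+1)%:E
      < +oo)%E).

(* The trace of f agrees with w almost everywhere on dD. *)
Definition trace_eq (Omega dD : set V) (f w : V -> V) : Prop :=
  forall i, exists g : V -> R, is_trace Omega (comp f i) g /\
    forall F : facet_idx M, boundary_facet Omega F ->
      {ae facet_measure F, forall x, dD x -> g x = comp w i x}.

Definition boundary_partition (Omega dD dN : set V) : Prop :=
  [/\ dD `|` dN = bnd Omega, dD `&` dN = set0, closed dD,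
      (0 < surface M Omega dD)%E
    & exists2 O : set V, open O & dN = O `&` bnd Omega].

End sobolev.

Section discrete.
Variables (R : realType) (n : nat) (M : simplicial_mesh R n).
Notation V := 'rV[R]_n.+1.

Definition affine (W : lmodType R) (f : V -> W) : Prop :=
  exists (L : {linear V -> W}) (b : W), forall x, f x = b + L x.

Definition P1 (W : lmodType R) (v : broken M W) : Prop :=
  forall k, affine (v k).

(* Equality on dD of the traces of two functions on the mesh, up to sets of zero
   surface measure: on a boundary facet the trace is taken from the cell that
   has this facet. *)
Definition broken_eq_on (W : Type) (Omega dD : set V) (v v' : broken M W) : Prop :=
  forall F : facet_idx M, boundary_facet Omega F ->
    {ae facet_measure F, forall x, dD x -> v F.1 x = v' F.1 x}.

Definition is_L2_projection (f : V -> V) (p : broken M V) : Prop :=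
  P1 p /\ forall q : broken M V, P1 q ->
    broken_int (fun k x => dotrV (f x - p k x) (q k x)) = 0.

Definition U_space (Omega dD : set V) (f : V -> V) (u : broken M V) : Prop :=
  P1 u /\ exists2 p, is_L2_projection f p & broken_eq_on Omega dD u p.

(* Internal facets are those shared by two distinct cells. *)
Definition zero_mean_jumps (a : broken M R) : Prop :=
  forall F F' : facet_idx M, F.1 != F'.1 -> facet F = facet F' ->
    \int[facet_measure F]_(x in facet F) (a F.1 x - a F'.1 x) = 0.

Definition A_space (Omega dD : set V) (a : broken M R) : Prop :=
  [/\ P1 a, zero_mean_jumps a & broken_eq_on Omega dD a (fun _ _ => 0)].

Definition K_set (Omega dD : set V) (a0 b : broken M R) : Prop :=
  A_space Omega dD b /\ forall k x, cell k x -> a0 k x <= b k x.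

Definition grad_h (a : broken M R) : broken M V :=
  fun k x => \row_i pderiv i (a k) x.

Definition sym_grad_h (u : broken M V) : broken M 'M[R]_n.+1 :=
  fun k x => \matrix_(i, j)
    ((pderiv j (comp (u k) i) x + pderiv i (comp (u k) j) x) / 2).

(* C e = lambda (1 (x) 1) e + 2 mu 1_4 e = lambda (tr e) 1 + 2 mu e *)
Definition hooke (lambda mu : R) (e : 'M[R]_n.+1) : 'M[R]_n.+1 :=
  (lambda * \tr e) *: 1%:M + (2 * mu) *: e.

Definition ddot (e e' : 'M[R]_n.+1) : R := \sum_i \sum_j e i j * e' i j.

Definition hooke_posdef (lambda mu : R) : Prop :=
  forall e : 'M[R]_n.+1, e^T = e -> e != 0 -> 0 < ddot (hooke lambda mu e) e.

Definition w_dissip (s : R) : R := s.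

Definition c_w : R :=
  4 * \int[@lebesgue_measure R]_(s in `[0, 1]%classic) Num.sqrt (w_dissip s).

Section forms.
Variables (lambda mu ell Gc : R).

Definition energy_density (u : broken M V) : broken M R :=
  fun k x => ddot (hooke lambda mu (sym_grad_h u k x)) (sym_grad_h u k x).

Definition A_form (u : broken M V) (a b : broken M R) : R :=
  broken_int (fun k x => energy_density u k x * a k x * b k x) +
  2 * Gc / c_w *
    broken_int (fun k x => ell * dotrV (grad_h a k x) (grad_h b k x)).

Definition f_form (u : broken M V) (b : broken M R) : R :=
  broken_int (fun k x => energy_density u k x * b k x) -
  Gc / c_w * broken_int (fun k x => b k x / ell).

End forms.

End discrete.

(* Main.v *)
(* The form A_h(u_h; ., .) is symmetric, bilinear and positive definite on the
   finite-dimensional space A_h, so the variational inequality is the first-order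
   condition of the minimization of a strictly convex coercive quadratic function
   over a nonempty closed convex set.

   Definiteness: if A_h(u_h; a, a) <= 0, then all the cell gradients of a vanish,
   so a is constant on each cell; the mean-value condition equates the constants
   of two cells sharing a facet, and the Dirichlet condition forces one of them to
   be 0.  It remains to go from one cell to any other through shared facets.
   Otherwise the mesh splits into two families of cells, with closed unions A and
   B that cover Omega and meet only in faces with at most n = d - 1 vertices.
   Such faces have codimension at least 2 and do not separate a ball: a generic
   segment joining two of its points avoids them.  Hence every ball included in
   Omega lies in A or in B, and so does Omega by connectedness, although every
   cell has interior points. *)
From HB Require Import structures.
Require Import Defs.
From mathcomp Require Import all_boot all_order all_algebra.
From mathcomp Require Import all_classical all_reals all_analysis.
From mathcomp Require Import measurable_realfun.
From mathcomp Require Import ring lra.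
From mathcomp Require polyrcf.
Set Implicit Arguments.
Unset Strict Implicit.
Unset Printing Implicit Defensive.
Import Order.TTheory GRing.Theory Num.Theory.
Import numFieldNormedType.Exports.
Local Open Scope classical_set_scope.
Local Open Scope ring_scope.

(** * Linear algebra: row spaces, Gram determinants and thin sets *)

Section linear_algebra.
Variable R : realType.

(** Take a matrix with the largest possible number of independent rows in [W]: a vector of [W]
    outside its row space could be appended as one more independent row. *)
Lemma subspace_row_space N (W : set 'rV[R]_N) :
  W 0 -> (forall s x y, W x -> W y -> W (s *: x + y)) ->
  exists m (A : 'M[R]_(m, N)),
    row_free A /\ forall x, W x <-> exists y, x = y *m A.
Proof.
move=> W0 Wl.
have Wspan m (A : 'M[R]_(m, N)) : (forall i, W (row i A)) -> forall y, W (y *m A).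
  move=> WA y; rewrite mulmx_sum_row; elim/big_ind: _ => // [a b Wa Wb|i _].
    by rewrite -[a]scale1r; exact: Wl.
  by rewrite -[_ *: _]addr0; apply: Wl.
pose P r := `[< exists A : 'M[R]_(r, N), row_free A /\ forall i, W (row i A) >].
have exP : exists r, P r.
  exists 0%N; apply/asboolP; exists 0; split; last by case.
  by rewrite /row_free mxrank0.
have boundP r : P r -> (r <= N)%N.
  by move=> /asboolP[A [/eqP rA _]]; rewrite -rA; exact: rank_leq_col.
case: (ex_maxnP exP boundP) => r /asboolP[A [fA WA]] maxr.
exists r, A; split=> // x; split=> [Wx|[y ->]]; last exact: Wspan.
have [|xA] := boolP (x <= A)%MS; first by move/submxP.
have : P (r + 1)%N.
  apply/asboolP; exists (col_mx A x); split.
    have : (\rank A < \rank (col_mx A x))%N.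
      by rewrite -addsmxE rank_ltmx// ltmxE addsmxSl addsmx_sub submx_refl.
    by move/eqP: fA => ->; rewrite /row_free eqn_leq rank_leq_row -addn1.
  by move=> i; case: (split_ordP i) => j ->; rewrite ?rowKu// rowKd row_id.
by move/maxr; rewrite addn1 ltnn.
Qed.

(* The determinant of the nonsingular matrices [x%:M + J J^T], x >= 0, does not
   change sign, and it is positive for large x. *)
Lemma det_gram_gt0 m N (J : 'M[R]_(m, N)) : row_free J -> 0 < \det (J *m J^T).
Proof.
move=> fJ.
pose p := char_poly (- (J *m J^T)).
have pE (x : R) : p.[x] = \det (x%:M + J *m J^T).
  rewrite /p /char_poly -horner_evalE -det_map_mx; congr (\det _).
  rewrite /char_poly_mx; apply/matrixP => i j.
  rewrite !mxE /= /horner_eval hornerD hornerN hornerC opprK.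
  by case: (i == j); rewrite ?mulr1n ?mulr0n ?hornerX ?hornerC.
(* A kernel vector [v] would satisfy [x |v|^2 + |v J|^2 = 0], hence [v J = 0], against the
   independence of the rows of [J]. *)
have pn0 x : 0 <= x -> p.[x] != 0.
  move=> x0; rewrite pE; apply/negP => /det0P[v v0].
  rewrite mulmxDr mul_mx_scalar => /(congr1 (fun z => (z *m v^T) ord0 ord0)).
  rewrite mulmxDl mulmxA -mulmxA -trmx_mul -scalemxAl mul0mx => /eqP.
  rewrite mxE [X in X + _]mxE !mxE.
  have sq_ge0 k (z : 'rV[R]_k) : 0 <= \sum_j z ord0 j * z^T j ord0.
    by apply: sumr_ge0 => i _; rewrite mxE -expr2 sqr_ge0.
  rewrite paddr_eq0 ?(mulr_ge0 x0) ?sq_ge0//.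
  move=> /andP[_]; rewrite psumr_eq0 => [|i _]; last by rewrite [X in _ * X]mxE -expr2 sqr_ge0.
  move=> /allP h; apply/negP: v0; rewrite negbK.
  have /eqP : v *m J = 0.
    apply/rowP => i; have := h i; rewrite mem_index_enum => /(_ isT) /=.
    by rewrite [X in _ * X]mxE mulf_eq0 orbb => /eqP ->; rewrite mxE.
  by rewrite mulmx_free_eq0.
have := pE 0; rewrite raddf0 add0r => <-.
rewrite lt_def pn0//= leNgt; apply/negP => p0.
have [x x0 px] : exists2 x, 0 <= x & 0 <= p.[x].
  have pp : 0 < lead_coef p by rewrite (monicP (char_poly_monic _)).
  have [n np] := polyrcf.poly_pinfty_gt_lc pp.
  exists (Num.max n 0); first by rewrite le_max lexx orbT.
  by apply: le_trans (ltW pp) (np _ _); rewrite le_max lexx.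
have : p.[0] <= 0 <= p.[x] by rewrite (ltW p0).
by case/(poly_ivt x0) => y /andP[y0 _]; rewrite rootE (negbTE (pn0 _ y0)).
Qed.

(* This is codimension at least 2, phrased so that no notion of dimension of a
   set is needed. *)
Definition thin N (E : set 'rV[R]_N) :=
  forall q : 'rV[R]_N, exists2 w : 'cV[R]_N, w != 0 &
    forall z, E z -> (z - q) *m w = 0.

Lemma thinS N (E E' : set 'rV[R]_N) : E `<=` E' -> thin E' -> thin E.
Proof.
by move=> EE' tE q; have [w w0 Ew] := tE q; exists w => // z /EE'; exact: Ew.
Qed.

Lemma hull_sub_ker N m (q : 'I_m -> 'rV[R]_N) (S : {set 'I_m}) (p : 'rV[R]_N)
    (w : 'cV[R]_N) :
  (forall j, j \in S -> (q j - p) *m w = 0) ->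
  forall z, hull q S z -> (z - p) *m w = 0.
Proof.
move=> qw z [b [b0 bS b1 ->]].
(* The weights sum to 1, so the shift by [p] distributes over the vertices. *)
have -> : \sum_j b j *: q j - p = \sum_j b j *: (q j - p).
  rewrite -[p in LHS]scale1r -b1 scaler_suml -sumrB.
  by apply: eq_bigr => j _; rewrite scalerBr.
rewrite mulmx_suml big1// => j _; rewrite -scalemxAl.
by have [/qw ->|/bS ->] := boolP (j \in S); rewrite ?scaler0 ?scale0r.
Qed.

(** Fewer than [N] difference vectors [q j - p] leave room for a nonzero vector orthogonal to all of
    them, whatever the base point [p]; it then annihilates the whole shifted hull. *)
Lemma thin_hull N m (q : 'I_m -> 'rV[R]_N) (S : {set 'I_m}) :
  (#|S| < N)%N -> thin (hull q S).
Proof.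
move=> SN p.
pose J : 'M[R]_(#|S|, N) := \matrix_i (q (enum_val i) - p).
have [w w0 Jw] : exists2 w : 'rV[R]_N, w != 0 & w *m J^T = 0.
  have : kermx J^T != 0.
    rewrite -mxrank_eq0 mxrank_ker mxrank_tr -lt0n subn_gt0.
    by rewrite (leq_ltn_trans (rank_leq_row J)).
  case/rowV0Pn => w /sub_kermxP wJ w0; by exists w.
exists w^T; first by rewrite trmx_eq0.
apply: hull_sub_ker => j jS.
have := congr1 trmx Jw; rewrite trmx_mul trmxK trmx0 => /(congr1 (row (enum_rank_in jS j))).
by rewrite row_mul rowK enum_rankK_in// row0.
Qed.

End linear_algebra.

(** * Continuity of sums and products of real functions *)

Lemma continuous_sumR (R : realType) (T : topologicalType) (I : finType)
    (f : I -> T -> R) :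
  (forall i, continuous (f i)) -> continuous (fun x => \sum_i f i x).
Proof.
by move=> fc; apply: continuous_big => [|i _]; [exact: add_continuous | exact: fc].
Qed.

Lemma continuous_mulR (R : realType) (T : topologicalType) (f g : T -> R) :
  continuous f -> continuous g -> continuous (fun x => f x * g x).
Proof. by move=> fc gc x; apply: cvgM; [exact: fc | exact: gc]. Qed.

Lemma continuous_addR (R : realType) (T : topologicalType) (f g : T -> R) :
  continuous f -> continuous g -> continuous (fun x => f x + g x).
Proof. by move=> fc gc x; apply: cvgD; [exact: fc | exact: gc]. Qed.

Lemma continuous_cst (T U : topologicalType) (c : U) :
  continuous (fun _ : T => c).
Proof. by move=> x; exact: cvg_cst. Qed.

(** * Variational inequalities in finite dimension *)

Section variational_inequality.
Variables (R : realType) (m : nat).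
Implicit Types (x y : 'rV[R]_m) (K : set 'rV[R]_m).

Lemma scalar_rV_sum (F : 'rV[R]_m -> R) :
  (forall s x y, F (s *: x + y) = s * F x + F y) ->
  forall x, F x = \sum_i x ord0 i * F (delta_mx ord0 i).
Proof.
move=> Fl x.
have F0 : F 0 = 0.
  by have := Fl (- 1) 0 0; rewrite scaler0 addr0 mulN1r addNr.
rewrite [in LHS](row_sum_delta x).
elim/big_rec2: _ => // i a b _ <-; exact: Fl.
Qed.

Lemma continuous_scalar_rV (F : 'rV[R]_m -> R) :
  (forall s x y, F (s *: x + y) = s * F x + F y) -> continuous F.
Proof.
move=> /scalar_rV_sum FE; rewrite (funext FE).
apply: continuous_sumR => i; apply: continuous_mulR; last exact: continuous_cst.
exact: coord_continuous.
Qed.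

Lemma ler_scalar_rV (F : 'rV[R]_m -> R) :
  (forall s x y, F (s *: x + y) = s * F x + F y) ->
  exists2 C, 0 <= C & forall x, `|F x| <= C * `|x|.
Proof.
move=> /scalar_rV_sum FE; exists (\sum_i `|F (delta_mx ord0 i)|).
  by apply: sumr_ge0.
move=> x; rewrite FE mulr_suml (le_trans (ler_norm_sum _ _ _))//.
apply: ler_sum => i _; rewrite normrM mulrC ler_wpM2l//.
by rewrite [leRHS]mx_normrE; apply: (le_bigmax _ _ (ord0, i)).
Qed.

Variables (B : 'rV[R]_m -> 'rV[R]_m -> R) (F : 'rV[R]_m -> R).
Hypothesis Bl : forall s x y z, B (s *: x + y) z = s * B x z + B y z.
Hypothesis Bsym : forall x y, B x y = B y x.
Hypothesis Bpos : forall x, x != 0 -> 0 < B x x.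
Hypothesis Fl : forall s x y, F (s *: x + y) = s * F x + F y.

Let Br z s x y : B z (s *: x + y) = s * B z x + B z y.
Proof. by rewrite Bsym Bl !(Bsym _ z). Qed.

Let continuous_B : continuous (fun x => B x x).
Proof.
have -> : (fun x => B x x) = fun x =>
    \sum_i x ord0 i * \sum_j x ord0 j * B (delta_mx ord0 i) (delta_mx ord0 j).
  apply/funext => x; rewrite (@scalar_rV_sum (B^~ x)) => [|s y z]; last exact: Bl.
  by apply: eq_bigr => i _; congr (_ * _); exact/scalar_rV_sum/Br.
apply: continuous_sumR => i; apply: continuous_mulR; first exact: coord_continuous.
apply: continuous_sumR => j; apply: continuous_mulR; last exact: continuous_cst.
exact: coord_continuous.
Qed.

(** The constant is the minimum of the quadratic form on the compact unit sphere, carried to all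
    vectors by homogeneity. The zero space is treated apart because its unit sphere is empty. *)
Let coercive : exists2 c, 0 < c & forall x, c * `|x| ^+ 2 <= B x x.
Proof.
have B0 x : B 0 x = 0.
  by have := Bl (- 1) 0 0 x; rewrite scaler0 addr0 mulN1r addNr.
have [S0|/existsNP[v /eqP v0]] := pselect (forall x : 'rV[R]_m, x = 0).
  by exists 1 => // x; rewrite (S0 x) normr0 B0 expr0n mulr0.
pose S := [set x : 'rV[R]_m | `|x| = 1].
have norm_cont : continuous (fun x : 'rV[R]_m => `|x|) by exact: norm_continuous.
have cS : compact S.
  apply: bounded_closed_compact; last first.
    by apply: (@closed_comp _ _ (fun x : 'rV[R]_m => `|x|) [set 1]) => // x _; exact: norm_cont.
  by exists 1; split=> // M M1 x /= ->; exact: ltW.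
have S_neq0 : S !=set0.
  exists (`|v|^-1 *: v); rewrite /S /= normrZ normfV normr_id mulVf//.
  by rewrite normr_eq0.
have [c cS' cmin] := EVT_min_rV S_neq0 cS (continuous_subspaceT continuous_B).
move: cS'; rewrite inE => c1.
exists (B c c).
  by apply: Bpos; apply: contra_eq_neq c1 => ->; rewrite normr0 eq_sym oner_eq0.
have BZ s x : B (s *: x) (s *: x) = s ^+ 2 * B x x.
  by rewrite -[s *: x]addr0 Bl !Br B0 (Bsym x 0) !B0; ring.
move=> x; have [->|x0] := eqVneq x 0.
  by rewrite normr0 expr0n mulr0 B0.
have := cmin (`|x|^-1 *: x); rewrite inE /S /= normrZ normfV normr_id.
rewrite mulVf ?normr_eq0// => /(_ erefl); rewrite BZ exprVn.
by rewrite mulrC ler_pdivlMr // exprn_gt0// normr_gt0.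
Qed.

(** The solution is a minimizer over [K] of the energy [J]; coercivity makes the part of [K] below
    the level [J x0] compact, so that a minimizer exists. *)
Theorem variational_inequality K x0 :
  closed K -> K x0 ->
  (forall t x y, 0 <= t <= 1 -> K x -> K y -> K (t *: (y - x) + x)) ->
  exists2 x, K x & forall y, K y -> F (y - x) <= B x (y - x).
Proof.
move=> clK Kx0 convK.
pose J x := B x x - F x *+ 2.
have J_cont : continuous J.
  apply: continuous_addR; first exact: continuous_B.
  rewrite (_ : (fun x => _) = fun x => - 2 * F x); last by apply/funext => x; ring.
  apply: continuous_mulR; [exact: continuous_cst | exact: continuous_scalar_rV].
have [c c0 cB] := coercive.
have [C C0 CF] := ler_scalar_rV Fl.
pose L := K `&` [set x | J x <= J x0].
have cL : compact L.
  apply: bounded_closed_compact; last first.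
    apply: closedI => //; apply: (@closed_comp _ _ J [set r | r <= J x0]) => [x _|].
      exact: J_cont.
    exact: closed_le.
  (* On the sublevel set, [c |x|^2 <= |J x0| + 2 C |x|]. When [|x| > 1] the right side is at most
     [(|J x0| + 2 C) |x|], which bounds [|x|]; the maximum with 1 covers the other vectors. *)
  exists (Num.max 1 ((`|J x0| + C *+ 2) / c)); split; first exact: num_real.
  move=> M Mgt x [_ /= Jx]; apply: le_trans (ltW Mgt).
  rewrite le_max; have [//|x1] := leP `|x| 1; rewrite orFb ler_pdivlMr//.
  have Fx : F x <= C * `|x| by apply: le_trans (CF x); exact: ler_norm.
  have h : c * `|x| ^+ 2 <= (`|J x0| + C *+ 2) * `|x|.
    have := cB x; have := ler_norm (J x0); move: Jx; rewrite /J => Jx hJ hc.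
    have : `|J x0| <= `|J x0| * `|x| by rewrite ler_peMr// ltW.
    move: hJ; rewrite /J; set a := `| _ |; move=> ? ?; lra.
  rewrite -(@ler_pM2r _ `|x|) ?(lt_trans ltr01)//.
  by rewrite (mulrC _ c) -mulrA -expr2.
have L0 : L !=set0 by exists x0; split => /=.
have [x xL xmin] := EVT_min_rV L0 cL (continuous_subspaceT J_cont).
move: xL; rewrite inE => -[Kx Jx].
have {}xmin y : K y -> J x <= J y.
  move=> Ky; have [Jy|/ltW Jy] := leP (J y) (J x0).
    by apply: xmin; rewrite inE.
  exact: le_trans Jy.
exists x => // y Ky; set d := y - x.
(* Minimality is tested at [x + t d], and the increment of [J] is divided by [t]. *)
have key t : 0 < t <= 1 -> 0 <= t * B d d + (B x d - F d) *+ 2.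
  move=> /andP[t0 t1]; have := xmin _ (convK t x y _ Kx Ky).
  rewrite (ltW t0) t1 => /(_ isT); rewrite /J Fl Bl !Br -/d (Bsym d x) => h.
  rewrite -(pmulr_rge0 _ t0); lra.
rewrite leNgt; apply/negP => g0.
have Bd : 0 <= B d d.
  have [->|/Bpos/ltW//] := eqVneq d 0.
  by have := cB 0; rewrite normr0 expr0n mulr0.
pose g := F d - B x d; have {}g0 : 0 < g by rewrite subr_gt0.
(* This [t] lies in []0, 1]] even if [B d d = 0], and [t * B d d <= g], so [key] would give
   [0 <= g - 2 g]. *)
pose t := g / (g + B d d).
have gB : 0 < g + B d d by rewrite ltr_wpDr.
have := key t; rewrite divr_gt0//= ler_pdivrMr// mul1r lerDl Bd => /(_ isT).
rewrite leNgt => /negP; apply.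
have : t * B d d <= g by rewrite /t mulrAC ler_pdivrMr// ler_wpM2l ?lerDr ?ltW.
rewrite /g in g0 *; lra.
Qed.

End variational_inequality.

(** * Borel sets, Lebesgue measure and simplex measures *)

Section measure_rV.
Variable R : realType.

(** The sigma-algebra is generated by the coordinates, so an open set is written as a countable
    union of boxes with rational centers and radii. *)
Lemma open_measurable_rV m (O : set 'rV[R]_m) : open O -> measurable O.
Proof.
move=> oO.
pose box (p : 'rV[rat]_m * rat) : set 'rV[R]_m :=
  [set x | forall i, `|x ord0 i - ratr (p.1 ord0 i)| < ratr p.2].
have mbox p : measurable (box p).
  rewrite (_ : box p = \bigcap_(i in [set: 'I_m])
      (@Defs.coord R m i @^-1` `]ratr (p.1 ord0 i) - ratr p.2,
                                 ratr (p.1 ord0 i) + ratr p.2[%classic)); last first.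
    apply/seteqP; split=> x /= h i.
      by move=> _; have := h i; rewrite /= in_itv /= -ltr_distlC distrC.
    by have := h i I; rewrite /= in_itv /= -ltr_distlC distrC.
  apply: fin_bigcap_measurable => // i _; rewrite -[X in measurable X]setTI.
  by apply: measurable_coord => //; exact: measurable_itv.
rewrite (_ : O = \bigcup_(p : 'rV[rat]_m * rat)
    (if `[< box p `<=` O >] then box p else set0)); last first.
  apply/seteqP; split => x; last by case=> p _; case: asboolP => // pO /pO.
  move=> Ox.
  have /nbhs_ballP[e /= e0 eO] : nbhs x O by apply: open_nbhs_nbhs.
  have [r] := rat_in_itvoo (divr_gt0 e0 (ltr0Sn R 1)).
  rewrite in_itv /= => /andP[r0 re].
  have /choice[q qx] i : exists q : rat, `|x ord0 i - ratr q| < ratr r.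
    have [q] : exists q, ratr q \in `]x ord0 i - ratr r, x ord0 i + ratr r[.
      by apply: rat_in_itvoo; rewrite ltrD2l gt0_cp.
    rewrite in_itv /= => /andP[q1 q2]; exists q.
    by rewrite ltr_norml; apply/andP; split; lra.
  exists (\row_i q i, r) => //.
  case: asboolP => [_ i|[]]; first by rewrite mxE; exact: qx.
  move=> y yq; apply: eO; split => // a i; rewrite (ord1 a).
  have := yq i; have := qx i; rewrite /= mxE /ball /= => h1 h2.
  rewrite -(subrKA (ratr (q i))) (le_lt_trans (ler_normD _ _))//.
  by rewrite [X in _ + X]distrC; lra.
apply: countable_bigcupT_measurable => // p.
by case: asboolP => // _; exact: measurable0.
Qed.

Lemma closed_measurable_rV m (A : set 'rV[R]_m) : closed A -> measurable A.
Proof.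
move=> cA; rewrite -[A]setCK; apply: measurableC; apply: open_measurable_rV.
exact: closed_openC.
Qed.

Lemma continuous_measurable_rV m (f : 'rV[R]_m -> R) :
  continuous f -> measurable_fun setT f.
Proof.
move=> /continuousP fc; apply: (measurability _ (RGenOpens.measurableE R)).
move=> _ [_ [a [b ->]] <-]; rewrite setTI.
by apply: open_measurable_rV; apply: fc; exact: interval_open.
Qed.

Lemma compact_measurable_rV m (A : set 'rV[R]_m) : compact A -> measurable A.
Proof.
by move=> /(compact_closed (@norm_hausdorff _ _))/closed_measurable_rV.
Qed.

Lemma integrable_continuous_compact m (mu : {measure set 'rV[R]_m -> \bar R})
    (K : set 'rV[R]_m) (f : 'rV[R]_m -> R) :
  compact K -> (mu K < +oo)%E -> continuous f -> mu.-integrable K (EFin \o f).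
Proof.
move=> cK muK fc; apply: measurable_bounded_integrable => //.
- exact: compact_measurable_rV.
- by apply: measurable_funS (continuous_measurable_rV fc).
have /compact_bounded[M [Mr fM]] := continuous_compact (continuous_subspaceT fc) cK.
by exists M; split=> // N /fM fN x Kx /=; apply: fN; exists x.
Qed.

Definition cube m (p : 'rV[R]_m) (s : R) : set 'rV[R]_m :=
  [set x | forall i, p ord0 i <= x ord0 i <= p ord0 i + s].

Lemma measurable_cube m (p : 'rV[R]_m) s : measurable (cube p s).
Proof.
rewrite (_ : cube p s = \bigcap_(i in [set: 'I_m])
    (@Defs.coord R m i @^-1` `[p ord0 i, p ord0 i + s]%classic)); last first.
  apply/seteqP; split=> x /= h i; first by move=> _ /=; rewrite in_itv; exact: h.
  by have := h i I; rewrite /= in_itv.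
apply: fin_bigcap_measurable => // i _; rewrite -[X in measurable X]setTI.
by apply: measurable_coord => //; exact: measurable_itv.
Qed.

(** The recursive construction of the measure turns a cube into an interval times a cube of one
    dimension less. Finiteness and positivity for the other sets below follow by comparison with
    cubes. *)
Lemma lebesgue_rV_cube m (p : 'rV[R]_m) s : 0 <= s ->
  lebesgue_rV R m (cube p s) = (s ^+ m)%:E.
Proof.
move=> s0; elim: m => [|m IH] in p *.
  by rewrite /= diracE mem_set// => -[].
rewrite /= /lebesgue_step /pushforward.
have -> : @consrV R m @^-1` cube p s =
    `[p ord0 ord0, p ord0 ord0 + s]%classic `*` cube (\row_j p ord0 (lift ord0 j)) s.
  apply/seteqP; split => -[a y]; rewrite /cube /consrV /=.
    move=> h; split.
      by have := h ord0; rewrite mxE unlift_none in_itv.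
    by move=> j; have := h (lift ord0 j); rewrite !mxE liftK.
  rewrite in_itv /= => -[ha hy] i; rewrite mxE.
  by case: unliftP => [j ->|->] //; have := hy j; rewrite mxE.
rewrite product_measure1E//; last exact: measurable_cube.
have leb_itv (a : R) : lebesgue_measure `[a, a + s]%classic = s%:E.
  rewrite lebesgue_measure_itv /= lte_fin -EFinB addrAC subrr add0r ltrDl.
  by move: s0; rewrite le_eqVlt => /predU1P[<-|->]//; rewrite ltxx.
rewrite IH exprS EFinM; congr (_ * _)%E; exact: leb_itv.
Qed.

Lemma lebesgue_rV_cube_fin m (A : set 'rV[R]_m) p s : 0 <= s ->
  measurable A -> A `<=` cube p s -> (lebesgue_rV R m A < +oo)%E.
Proof.
move=> s0 mA As; apply: le_lt_trans (ltry (s ^+ m)).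
rewrite -(lebesgue_rV_cube p s0); apply: le_measure; rewrite ?inE//.
exact: measurable_cube.
Qed.

Lemma lebesgue_rV_cube_gt0 m (A : set 'rV[R]_m) p s : 0 < s ->
  measurable A -> cube p s `<=` A -> (0 < lebesgue_rV R m A)%E.
Proof.
move=> s0 mA As; apply: lt_le_trans (_ : (s ^+ m)%:E <= _)%E.
  by rewrite lte_fin exprn_gt0.
rewrite -(lebesgue_rV_cube p (ltW s0)); apply: le_measure; rewrite ?inE//.
exact: measurable_cube.
Qed.

Lemma lebesgue_rV_compact m (K : set 'rV[R]_m) :
  compact K -> (lebesgue_rV R m K < +oo)%E.
Proof.
move=> cK; have /compact_bounded[M [_ KM]] := cK.
pose N := Num.max M 0 + 1.
have N0 : 0 <= N by rewrite addr_ge0// le_max lexx orbT.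
have NM : M < N by rewrite ltr_pwDr// le_max lexx.
apply: (@lebesgue_rV_cube_fin _ _ (const_mx (- N)) (N *+ 2)).
- exact: mulrn_wge0.
- exact: compact_measurable_rV.
move=> x Kx i; rewrite mxE mulr2n addrA addNr add0r.
rewrite -ler_norml; apply: le_trans (KM N NM x Kx).
by rewrite [leRHS]mx_normrE; apply: (le_bigmax _ _ (ord0, i)).
Qed.

Lemma lebesgue_rV_nbhs_gt0 m (A : set 'rV[R]_m) (p : 'rV[R]_m) :
  measurable A -> nbhs p A -> (0 < lebesgue_rV R m A)%E.
Proof.
move=> mA /nbhs_ballP[e /= e0 eA].
apply: (@lebesgue_rV_cube_gt0 _ _ p (e / 2)) => //; first by rewrite divr_gt0.
move=> x px; apply: eA; split=> // a i; rewrite (ord1 a).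
have /andP[p1 p2] := px i; rewrite /ball /= distrC ger0_norm; lra.
Qed.

Lemma std_simplex_fin m : (lebesgue_rV R m (@std_simplex R m) < +oo)%E.
Proof.
apply: (@lebesgue_rV_cube_fin _ _ 0 1) => //; first exact: measurable_std_simplex.
move=> x [x0 x1] i; rewrite mxE add0r x0 /= (le_trans _ x1)//.
by rewrite (bigD1 i)//= lerDl sumr_ge0.
Qed.

Lemma std_simplex_gt0 m : (0 < lebesgue_rV R m (@std_simplex R m))%E.
Proof.
(* In the cube of side [1 / (m + 1)] at the origin the coordinates sum to at most [m / (m + 1)]; the
   denominator stays nonzero for [m = 0]. *)
apply: (@lebesgue_rV_cube_gt0 _ _ 0 (m.+1%:R^-1)) => //.
  exact: measurable_std_simplex.
move=> x hx; split=> [i|]; first by have := hx i; rewrite mxE => /andP[].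
have : \sum_i x ord0 i <= \sum_(i < m) (m.+1%:R^-1 : R).
  by apply: ler_sum => i _; have := hx i; rewrite mxE add0r => /andP[].
move=> /le_trans; apply; rewrite sumr_const card_ord -[_ *+ m]mulr_natl.
by rewrite ler_pdivrMr// mul1r ler_nat.
Qed.

Lemma gram_factor_gt0 d m (q : 'I_m.+1 -> 'rV[R]_d) :
  affinely_independent q -> 0 < (gram_factor q)%:num.
Proof. by move=> /det_gram_gt0; rewrite /gram_factor /= sqrtr_gt0. Qed.

Lemma simplex_param_hull d m (q : 'I_m.+1 -> 'rV[R]_d) t :
  std_simplex t -> hull q [set: _] (simplex_param q t).
Proof.
move=> [t0 t1].
(* Barycentric coordinates: [t] on the vertices other than the first, and the remaining weight on
   the first. *)
pose b (j : 'I_m.+1) := if unlift ord0 j is Some i then t ord0 i else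
  1 - \sum_i t ord0 i.
have b0 : b ord0 = 1 - \sum_i t ord0 i by rewrite /b unlift_none.
have bl i : b (lift ord0 i) = t ord0 i by rewrite /b liftK.
exists b; split.
- by move=> j; rewrite /b; case: unlift => [i|]; [exact: t0|rewrite subr_ge0].
- by move=> j; rewrite inE.
- by rewrite big_ord_recl b0 (eq_bigr _ (fun i _ => bl i)) subrK.
rewrite big_ord_recl b0 (eq_bigr _ (fun i _ => congr1 (fun r => r *: _) (bl i))).
rewrite /simplex_param mulmx_sum_row.
rewrite (eq_bigr (fun i => t ord0 i *: q (lift ord0 i) - t ord0 i *: q ord0)).
  by rewrite sumrB -scaler_suml scalerBl scale1r addrA addrAC.
by move=> i _; rewrite rowK scalerBr.
Qed.

Lemma simplex_measure_fin d m (q : 'I_m.+1 -> 'rV[R]_d) A :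
  measurable A -> (simplex_measure q A < +oo)%E.
Proof.
move=> mA; rewrite /simplex_measure.
rewrite lte_mul_pinfty ?lee_fin//.
apply: le_lt_trans (std_simplex_fin m); apply: le_measure => //; rewrite ?inE.
- apply: measurableI; last exact: measurable_std_simplex.
  by rewrite -[X in measurable X]setTI; exact: measurable_simplex_param.
- exact: measurable_std_simplex.
Qed.

Lemma simplex_measure_hull_gt0 d m (q : 'I_m.+1 -> 'rV[R]_d) A :
  affinely_independent q -> hull q [set: _] `<=` A -> (0 < simplex_measure q A)%E.
Proof.
move=> aq qA; rewrite /simplex_measure mule_gt0 ?lte_fin ?gram_factor_gt0//.
rewrite (_ : _ `&` _ = @std_simplex R m); first exact: std_simplex_gt0.
by apply/setIidr => t /(simplex_param_hull q)/qA.
Qed.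

End measure_rV.

(** * Topology of simplices and avoidance of hyperplanes *)

Section topology_rV.
Variable R : realType.

Lemma continuous_rV (T : topologicalType) m (f : T -> 'rV[R]_m) :
  (forall i, continuous (fun x => f x ord0 i)) -> continuous f.
Proof.
move=> fc x; apply/cvg_ballP => e e0.
have : \forall y \near x, forall i, ball (f x ord0 i) e (f y ord0 i).
  by apply: filter_forall => i; exact: (cvg_ball (fc i x)).
by apply: filterS => y xy; split=> // a i; rewrite (ord1 a); exact: xy.
Qed.

Lemma continuous_mulmx_coord m p (a : 'rV[R]_m) (A : 'M[R]_(m, p)) i :
  continuous (fun x : 'rV[R]_m => ((x - a) *m A) ord0 i).
Proof.
rewrite (_ : (fun x => _) =
    fun x : 'rV[R]_m => \sum_j x ord0 j * A j i - (a *m A) ord0 i).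
  apply: continuous_addR; last exact: continuous_cst.
  apply: continuous_sumR => j; apply: continuous_mulR; last exact: continuous_cst.
  exact: coord_continuous.
by apply/funext => x; rewrite mulmxBl !mxE.
Qed.

Lemma continuous_mulmxr m p (A : 'M[R]_(m, p)) :
  continuous (fun x : 'rV[R]_m => x *m A).
Proof.
apply: continuous_rV => i; have := @continuous_mulmx_coord m p 0 A i.
by under eq_fun do rewrite subr0.
Qed.

(** The hull is the image, under a linear map, of the closed and bounded set [D] of barycentric
    weights. *)
Lemma compact_hull d m (q : 'I_m -> 'rV[R]_d) (S : {set 'I_m}) :
  compact (hull q S).
Proof.
pose D := [set b : 'rV[R]_m | [/\ forall j, 0 <= b ord0 j,
  forall j, j \notin S -> b ord0 j = 0 & \sum_j b ord0 j = 1]].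
have -> : hull q S = (fun b => b *m \matrix_j q j) @` D.
  apply/seteqP; split=> [x [b [b0 bS b1 ->]]|x [b [b0 bS b1 <-]]].
    exists (\row_j b j); last first.
      by rewrite mulmx_sum_row; apply: eq_bigr => j _; rewrite mxE rowK.
    split=> [j|j /bS|]; rewrite ?mxE//.
    by rewrite -b1; apply: eq_bigr => j _; rewrite mxE.
  exists (b ord0); split => //.
  by rewrite mulmx_sum_row; apply: eq_bigr => j _; rewrite rowK.
apply: continuous_compact; first exact/continuous_subspaceT/continuous_mulmxr.
apply: bounded_closed_compact.
  exists 1; split=> // M M1 b [b0 bS b1]; apply: le_trans (ltW M1).
  rewrite [leLHS]mx_normrE; apply/bigmax_leP; split=> // -[a j] _ /=.
  by rewrite (ord1 a) ger0_norm// -b1 (bigD1 j)//= lerDl sumr_ge0.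
have cc i : continuous (fun b : 'rV[R]_m => b ord0 i) by exact: coord_continuous.
have -> : D = \bigcap_(j in [set: 'I_m]) [set b | 0 <= b ord0 j] `&`
    (\bigcap_(j in [set j | j \notin S]) [set b | b ord0 j = 0] `&`
     [set b | \sum_j b ord0 j = 1]).
  apply/seteqP; split=> b; first by move=> [b0 bS b1]; split=> // j _; exact: b0.
  by move=> [b0 [bS b1]]; split=> // j; exact: b0.
apply: closedI; last apply: closedI.
- apply: closed_bigI => j _.
  apply: (@closed_comp _ _ (fun b : 'rV[R]_m => b ord0 j) [set r | 0 <= r]) => [x _|].
    exact: cc.
  exact: closed_ge.
- apply: closed_bigI => j _.
  apply: (@closed_comp _ _ (fun b : 'rV[R]_m => b ord0 j) [set r | r = 0]) => [x _|].
    exact: cc.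
  exact: closed_eq.
- apply: (@closed_comp _ _ (fun b : 'rV[R]_m => \sum_j b ord0 j) [set r | r = 1]).
    by move=> x _; exact: (continuous_sumR cc).
  exact: closed_eq.
Qed.

Lemma near_forall_gt (T : topologicalType) (I : finType) (f : I -> T -> R) p a :
  (forall i, continuous (f i)) -> (forall i, a < f i p) ->
  \forall x \near p, forall i, a < f i x.
Proof.
move=> fc fa; apply: filter_forall => i.
by apply: (cvgr_gt _ (fc i p)); exact: fa.
Qed.

Lemma near_lt (T : topologicalType) (f : T -> R) p a :
  continuous f -> f p < a -> \forall x \near p, f x < a.
Proof. by move=> fc fa; apply: (cvgr_lt _ (fc p)). Qed.

(** The point is the barycenter. The coordinates [g] inverting [simplex_param] are continuous, and
    the inequalities defining the standard simplex are strict there, so they persist nearby. *)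
Lemma hull_interior d (q : 'I_d.+1 -> 'rV[R]_d) :
  affinely_independent q -> exists p : 'rV[R]_d, nbhs p (hull q [set: _]).
Proof.
move=> qf; have Eu : edges q \in unitmx by rewrite -row_free_unit.
pose c : R := d.+1%:R^-1.
pose g (x : 'rV[R]_d) := (x - q ord0) *m invmx (edges q).
pose p := simplex_param q (const_mx c).
have gp : g p = const_mx c by rewrite /g /p /simplex_param addrAC subrr add0r mulmxK.
have gci i : continuous (fun x => g x ord0 i) by exact: continuous_mulmx_coord.
exists p.
have h1 : \forall x \near p, forall i, 0 < g x ord0 i.
  by apply: near_forall_gt => // i; rewrite gp mxE invr_gt0.
have h2 : \forall x \near p, \sum_i g x ord0 i < 1.
  apply: near_lt; first exact: continuous_sumR gci.
  rewrite gp (eq_bigr (fun=> c)) => [|i _]; last by rewrite mxE.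
  by rewrite sumr_const card_ord -[_ *+ d]mulr_natl ltr_pdivrMr// mul1r ltr_nat.
apply: filterS2 h1 h2 => x g0 g1.
rewrite -[x](_ : simplex_param q (g x) = x).
  by apply: simplex_param_hull; split=> [i|]; apply: ltW.
by rewrite /simplex_param /g mulmxKV// addrC subrK.
Qed.

(** From a point of [U] on the hyperplane, a small displacement along the normal [w^T] stays in [U]
    and leaves the hyperplane. *)
Lemma avoid_hyperplane d (U : set 'rV[R]_d) (w : 'cV[R]_d) q :
  open U -> U !=set0 -> w != 0 -> U `&` [set p | (p - q) *m w != 0] !=set0.
Proof.
move=> oU [p Up] w0.
have [pw|pw] := eqVneq ((p - q) *m w) 0; last by exists p.
have lc : continuous (fun e : R => e *: w^T + p).
  apply: continuous_rV => i.
  rewrite (_ : (fun x => _) = fun e : R => e * w^T ord0 i + p ord0 i); last first.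
    by apply/funext => e; rewrite !mxE.
  apply: continuous_addR; last exact: continuous_cst.
  by apply: continuous_mulR; [move=> ? | exact: continuous_cst].
have : nbhs (0 : R) ((fun e : R => e *: w^T + p) @^-1` U).
  apply: open_nbhs_nbhs; split; last by rewrite /= scale0r add0r.
  by move/continuousP : lc; exact.
move=> /nbhs_ballP[r /= r0 rU].
have e0 : 0 < r / 2 by rewrite divr_gt0.
have {rU} := rU (r / 2); rewrite /ball /= sub0r normrN gtr0_norm//.
rewrite ltr_pdivrMr// ltr_pMr// ltr1n => /(_ isT); move: (r / 2) e0 => e e0 eU.
exists (e *: w^T + p); split=> //=.
rewrite -addrA mulmxDl pw addr0 -scalemxAl scaler_eq0 (gt_eqF e0)/=.
apply: contraNneq w0 => /(congr1 (fun z : 'M[R]_1 => z ord0 ord0)).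
rewrite !mxE => /eqP; rewrite psumr_eq0 => [/allP h|i _]; last first.
  by rewrite mxE -expr2 sqr_ge0.
apply/eqP/colP => i; have := h i; rewrite mem_index_enum => /(_ isT).
by rewrite !mxE mulf_eq0 orbb => /eqP.
Qed.

(** Induction with [U] general: removing one hyperplane leaves a nonempty open set, in which the
    others can be avoided. *)
Lemma avoid_hyperplanes d (I : finType) (U : set 'rV[R]_d) (w : I -> 'cV[R]_d) q :
  open U -> U !=set0 -> (forall i, w i != 0) ->
  exists2 p, U p & forall i, (p - q) *m w i != 0.
Proof.
move=> oU U0 w0.
suff : forall s : seq I, exists2 p, U p & forall i, i \in s -> (p - q) *m w i != 0.
  by move=> /(_ (enum I))[p Up h]; exists p => // i; apply: h; rewrite mem_enum.
move=> s; elim: s => [|i s IH] in U oU U0 *; first by have [p] := U0; exists p.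
have [||p [Up pi] ps] := IH (U `&` [set p | (p - q) *m w i != 0]).
- apply: openI => //.
  rewrite (_ : [set p | _] = ~` ((fun p => ((p - q) *m w i) ord0 ord0) @^-1` [set 0])).
    apply: closed_openC; apply: closed_comp; last exact: closed_eq.
    by move=> x _; exact: continuous_mulmx_coord.
  apply/seteqP; split=> p /=.
    by move=> /negP pw h; apply: pw; apply/eqP/matrixP => a b; rewrite !ord1 h mxE.
  by move=> h; apply/negP => /eqP pw; apply: h; rewrite pw mxE.
- exact: avoid_hyperplane.
exists p => // j; rewrite inE => /predU1P[->//|]; exact: ps.
Qed.

End topology_rV.

(** * Connectivity of the mesh through shared facets *)

Section facet_connectivity.
Variable R : realType.

(** With [p] as base point, each thin set lies in a hyperplane through [p], and finitely many
    hyperplanes do not fill the interior of [A]. *)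
Lemma thin_cover_interior d (I : finType) (E : I -> set 'rV[R]_d) (A : set 'rV[R]_d)
    (p : 'rV[R]_d) :
  (forall i, thin (E i)) -> A `<=` \bigcup_i E i -> ~ nbhs p A.
Proof.
move=> tE AE pA.
have /choice[w wE] i : exists w : 'cV[R]_d, w != 0 /\
    forall z, E i z -> (z - p) *m w = 0 by have [w] := tE i p; exists w.
have [||i|z Az zw] := @avoid_hyperplanes _ _ _ A° w p.
- exact: open_interior.
- by exists p.
- by have [] := wE i.
have [i _ Eiz] := AE z (interior_subset Az).
by have := zw i; rewrite (wE i).2 ?eqxx.
Qed.

(* A segment from [q] outside [B] to a generic [p] outside [A] avoids the sets
   [E i], because each of them lies in a hyperplane through [q]. *)
Lemma convex_thin_split d (I : finType) (E : I -> set 'rV[R]_d)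
    (A B U : set 'rV[R]_d) :
  closed A -> closed B -> A `&` B `<=` \bigcup_i E i -> (forall i, thin (E i)) ->
  open U -> U `<=` A `|` B ->
  (forall t p q, 0 <= t <= 1 -> U p -> U q -> U (t *: (p - q) + q)) ->
  U `<=` A \/ U `<=` B.
Proof.
move=> cA cB ABE tE oU UAB cvxU; apply: contrapT.
move=> /not_orP[/existsNP[p0 /not_implyP[Up0 Ap0]] /existsNP[q /not_implyP[Uq Bq]]].
have /choice[w wE] i : exists w : 'cV[R]_d, w != 0 /\
    forall z, E i z -> (z - q) *m w = 0 by have [w] := tE i q; exists w.
have [||i|p [Up Ap] pw] := @avoid_hyperplanes _ _ _ (U `&` ~` A) w q.
- by apply: openI => //; exact: closed_openC.
- by exists p0.
- by have [] := wE i.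
pose g (t : R) := t *: (p - q) + q.
have gc : continuous g.
  apply: continuous_rV => i.
  rewrite (_ : (fun x => _) = fun t : R => t * (p - q) ord0 i + q ord0 i); last first.
    by apply/funext => t; rewrite !mxE.
  apply: continuous_addR; last exact: continuous_cst.
  by apply: continuous_mulR; [move=> ? | exact: continuous_cst].
have gU t : t \in `[0, 1] -> U (g t) by rewrite in_itv /= => t01; exact: cvxU.
(* A point of the segment in both sets lies on one of the hyperplanes through [q]. As [p] is off
   that hyperplane, the point is [q], which is not in [B]. *)
have AnB t : t \in `[0, 1] -> A (g t) -> ~ B (g t).
  move=> t01 At Bt; have [i _ Ei] := ABE _ (conj At Bt).
  have := (wE i).2 _ Ei; rewrite /g addrK -scalemxAl => /eqP.
  rewrite scaler_eq0 (negbTE (pw i)) orbF => /eqP t0.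
  by apply: Bq; move: Bt; rewrite /g t0 scale0r add0r.
have Aq : A q by have [] := UAB q Uq.
(* The parameters sent to [A] form a nonempty open and closed part of the interval, so the end [p]
   would be in [A]. *)
have : `[0, 1]%classic `&` g @^-1` A = `[0, 1]%classic.
  apply: (@segment_connected R 0 1).
- by exists 0; rewrite /= in_itv /= lexx ler01 /g scale0r add0r.
- exists (g @^-1` ~` B).
    by move/continuousP : gc; apply; exact: closed_openC.
  apply/seteqP; split=> t /= [t01 gt]; split=> //; first exact: AnB.
  by have [] := UAB _ (gU t t01).
- by exists (g @^-1` A) => //; apply: closed_comp => // t _; exact: gc.
move=> /seteqP[_ /(_ 1)]; rewrite /= in_itv /= lexx ler01 => /(_ isT)[_].
by rewrite /g scale1r subrK.
Qed.

(** Balls are convex, so every point of [U] is interior to [A] or to [B]. The two interiors are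
    disjoint, hence [A°] cuts out an open and closed part of [U]. *)
Lemma connected_thin_split d (I : finType) (E : I -> set 'rV[R]_d)
    (A B U : set 'rV[R]_d) :
  closed A -> closed B -> A `&` B `<=` \bigcup_i E i -> (forall i, thin (E i)) ->
  open U -> connected U -> U `<=` A `|` B -> U `<=` A \/ U `<=` B.
Proof.
move=> cA cB ABE tE oU connU UAB.
have loc x : U x -> A° x \/ B° x.
  move=> Ux; have /nbhs_ballP[e /= e0 eU] : nbhs x U by exact: open_nbhs_nbhs.
  have xe : nbhs x (ball x e) by exact: nbhsx_ballx.
  have [|||eA|eB] := @convex_thin_split _ _ E A B (ball x e) cA cB ABE tE.
  - exact: ball_open.
  - by move=> y /eU/UAB.
  - move=> t p q /andP[t0 t1] [_ xp] [_ xq]; split=> // a i.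
    have := xp a i; have := xq a i; rewrite /ball /= !mxE => hq hp.
    rewrite (_ : _ - _ = t * (x a i - p a i) + (1 - t) * (x a i - q a i)); last by ring.
    apply: le_lt_trans (ler_normD _ _) _; rewrite !normrM.
    rewrite (ger0_norm t0) (@ger0_norm _ (1 - t)) ?subr_ge0//.
    (* The strict bound is taken from the term with factor [t], which requires [t > 0]. *)
    have [->|tn0] := eqVneq t 0; first by rewrite mul0r add0r subr0 mul1r.
    have tp : 0 < t by rewrite lt_def tn0.
    have : t * `|x a i - p a i| < t * e by rewrite ltr_pM2l.
    have : (1 - t) * `|x a i - q a i| <= (1 - t) * e by rewrite ler_wpM2l ?subr_ge0// ltW.
    by move=> h1 h2; rewrite (lt_le_trans (ltr_leD h2 h1))// -mulrDl addrC subrK mul1r.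
  - by left; apply: filterS xe.
  - by right; apply: filterS xe.
have disj x : A° x -> ~ B° x.
  by move=> xA xB; apply: (thin_cover_interior tE ABE (p := x)); exact: filterI.
have [[x [Ux Ax]]|UA0] := pselect (U `&` A° !=set0).
  left; rewrite -[X in X `<=` _](connU (U `&` A°)).
  - by move=> y [_] /interior_subset.
  - by exists x.
  - by exists A° => //; exact: open_interior.
  - exists (~` B°); first by apply: open_closedC; exact: open_interior.
    apply/seteqP; split=> y [Uy]; first by move=> /disj.
    by have [Ay|By] := loc y Uy.
right=> x Ux; have [Ax|] := loc x Ux; last exact: interior_subset.
by exfalso; apply: UA0; exists x.
Qed.

Variables (n : nat) (M : simplicial_mesh R n).
Notation V := 'rV[R]_n.+1.

Lemma closed_cell k : closed (@cell _ _ M k).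
Proof. apply: compact_closed; [exact: norm_hausdorff | exact: compact_hull]. Qed.

Lemma card_neqT m (S : {set 'I_m.+1}) : S != [set: _]%SET -> (#|S| <= m)%N.
Proof.
move=> ST; have : (#|S| < #|[set: 'I_m.+1]%SET|)%N by rewrite proper_card// properT.
by rewrite cardsT card_ord ltnS.
Qed.

(** Thinness for the vertices other than [v], with base point [q v], gives a hyperplane through
    [q v] that contains the entire hull. *)
Lemma hull_proper_interior (q : 'I_n.+2 -> V) (S : {set 'I_n.+2}) (p : V) :
  S != [set: _]%SET -> ~ nbhs p (hull q S).
Proof.
move=> SnT.
have Sle := card_neqT SnT.
have [->|[v vS]] := set_0Vmem S.
  move=> /nbhs_singleton[b [_ b0 b1 _]].
  by move: b1; rewrite big1 => [/eqP|j _]; rewrite ?b0 ?inE// eq_sym oner_eq0.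
have : thin (hull q (S :\ v)).
  by apply: thin_hull; rewrite -ltnS; move: Sle; rewrite (cardsD1 v) vS.
move=> /(_ (q v)) [w w0 wS] pS.
have [z] := avoid_hyperplane (q v) (open_interior (hull q S)) (ex_intro _ p pS) w0.
move=> [/interior_subset zS /=].
rewrite (hull_sub_ker _ zS) ?eqxx// => j jS.
have [->|jv] := eqVneq j v; first by rewrite subrr mul0mx.
apply: wS; exists (fun i => (i == j)%:R); split=> [i|i||].
- by rewrite ler0n.
- by rewrite !inE; have [->|//] := eqVneq i j; rewrite jv jS.
- by rewrite (bigD1 j)//= eqxx big1 ?addr0// => i /negbTE ->.
- by rewrite (bigD1 j)//= eqxx scale1r big1 ?addr0// => i /negbTE ->; rewrite scale0r.
Qed.

(** Suppose that both descriptions of the common face have at least [n + 1] vertices. If one used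
    all the vertices, a cell would be a face of the other; its interior points would force the two
    cells to coincide or a proper face to have interior. Otherwise each omits exactly one vertex,
    and the cells share a facet. *)
Lemma cells_thinI k l : k != l ->
  (forall i j, facet (k, i) <> facet (l, j) :> set V) ->
  thin (@cell _ _ M k `&` @cell _ _ M l).
Proof.
move=> kl nF; have [S [S' [ES ES']]] := matching kl.
have [|Sn] := ltnP #|S| n.+1; first by move=> /thin_hull; rewrite ES; exact.
have [|Sn'] := ltnP #|S'| n.+1; first by move=> /thin_hull; rewrite ES'; exact.
have full (m : 'I_(ncells M)) (T : {set 'I_n.+2}) (p : V) : nbhs p (hull (vertex m) T) -> T = [set: _]%SET.
  by move=> pT; apply/eqP; apply: contraPT pT; exact: hull_proper_interior.
have [pk pkP] := hull_interior (vertex_indep k).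
have [pl plP] := hull_interior (vertex_indep l).
exfalso; have [ST|SnT] := eqVneq S [set: _]%SET.
  have kE : cell k = hull (vertex l) S' by rewrite -ES' ES ST.
  have S'T : S' = [set: _]%SET by apply: (full l _ pk); rewrite -kE.
  by move/eqP: kl; apply; apply: (@cell_inj _ _ M); rewrite kE S'T.
have [ST'|SnT'] := eqVneq S' [set: _]%SET.
  have lE : cell l = hull (vertex k) S by rewrite -ES ES' ST'.
  by move/eqP: SnT; apply; apply: (full k _ pl); rewrite -lE.
have coS (T : {set 'I_n.+2}) : (n.+1 <= #|T|)%N -> T != [set: _]%SET -> exists i, T = [set~ i]%SET.
  move=> nT TnT; have /cards1P[i Ti] : #|~: T| == 1%N.
    rewrite -(eqn_add2l #|T|) cardsC card_ord addn1 eqSS eqn_leq nT.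
    exact: card_neqT.
  by exists i; rewrite -Ti finset.setCK.
have [i Si] := coS _ Sn SnT; have [j Sj] := coS _ Sn' SnT'.
by apply: (nF i j); rewrite /facet /= -Si -Sj -ES.
Qed.

(** Stated for any property [P] of cells that passes through shared facets; the two families are the
    cells with and without [P]. *)
Lemma facet_connected (Omega : set V) (P : pred 'I_(ncells M)) :
  open Omega -> connected Omega -> fits M Omega ->
  (forall F F' : facet_idx M, F.1 != F'.1 -> facet F = facet F' -> P F.1 -> P F'.1) ->
  forall k l, P k -> P l.
Proof.
move=> oO cO hM hP k l Pk; apply/negPn/negP => Pl.
pose A := \bigcup_(i in [set i | P i]) @cell _ _ M i.
pose B := \bigcup_(i in [set i | ~~ P i]) @cell _ _ M i.
have cA : closed A by apply: closed_bigcup => [|i _]; [exact: finite_finset | exact: closed_cell].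
have cB : closed B by apply: closed_bigcup => [|i _]; [exact: finite_finset | exact: closed_cell].
pose E (ij : 'I_(ncells M) * 'I_(ncells M)) :=
  if P ij.1 && ~~ P ij.2 then @cell _ _ M ij.1 `&` @cell _ _ M ij.2 else set0.
have ABE : A `&` B `<=` \bigcup_ij E ij.
  by move=> x [[i Pi xi] [j Pj xj]]; exists (i, j) => //; rewrite /E /= Pi Pj.
have tE ij : thin (E ij).
  rewrite /E; case: ifPn => [/andP[Pi Pj]|_]; last first.
    by apply: thinS (@thin_hull _ _ _ (fun _ : 'I_0 => 0) finset.set0 _); rewrite ?cards0.
  have ij12 : ij.1 != ij.2 by apply: contraNneq Pj => <-.
  apply: cells_thinI => // i j ij'; apply/negP: Pj; rewrite negbK.
  exact: (hP (ij.1, i) (ij.2, j)).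
have OAB : closure Omega = A `|` B.
  rewrite hM; apply/seteqP; split => x.
    by move=> [i _ xi]; have [Pi|Pi] := boolP (P i); [left|right]; exists i.
  by move=> [[i _ xi]|[i _ xi]]; exists i.
have nsub m : ~ @cell _ _ M m `<=` A `&` B.
  move=> mAB; have [p pm] := hull_interior (vertex_indep m).
  exact: (thin_cover_interior tE (subset_trans mAB ABE) (p := p)).
have [|OA|OB] := connected_thin_split cA cB ABE tE oO cO.
- by rewrite -OAB; exact: subset_closure.
(* The inclusion passes to the closure of [Omega], so the cell [l] lies in both unions although
   their overlap has no interior. *)
- apply: (nsub l) => x xl.
  have Bx : B x by exists l.
  split=> //; rewrite (closure_id A).1//; apply: (closure_subset OA).
  by rewrite OAB; right.
- apply: (nsub k) => x xk.
  have Ax : A x by exists k.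
  split=> //; rewrite (closure_id B).1//; apply: (closure_subset OB).
  by rewrite OAB; left.
Qed.

End facet_connectivity.

(** * Positivity of the dissipation constant *)

Section dissipation_constant.

(** The square root is at least 1/2 on [[1/4, 1]], which gives positivity. The upper bound by 1
    excludes an infinite integral, which [fine] would send to 0. *)
Lemma c_w_gt0 (R : realType) : 0 < c_w R.
Proof.
have leb (a b : R) : a < b -> lebesgue_measure `[a, b]%classic = (b - a)%:E.
  by move=> ab; rewrite lebesgue_measure_itv /= lte_fin ab -EFinB.
rewrite /c_w mulr_gt0// /Rintegral fine_gt0//.
have msqrt D : measurable D ->
    measurable_fun D (fun s : measurableTypeR R => (Num.sqrt (w_dissip s))%:E).
  move=> mD; apply/measurable_EFinP; apply: measurable_funTS.
  by apply: continuous_measurable_fun; exact: sqrt_continuous.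
apply/andP; split; last first.
  apply: (@le_lt_trans _ _ (\int[lebesgue_measure]_(x in `[0%R, 1%R]%classic) (cst 1 x))%E).
    apply: ge0_le_integral => //=; first exact: msqrt.
    - move=> s; rewrite /= in_itv /= => /andP[s0 s1].
      by rewrite lee_fin /w_dissip -[leRHS]sqrtr1 ler_sqrt.
  rewrite integral_cst// mul1e [ltLHS](_ : _ = (1 - 0)%:E) ?ltry//.
  exact: leb.
have s14 : `[4^-1, 1 : R]%classic `<=` `[0, 1]%classic.
  by apply: subset_itvr; rewrite bnd_simp.
pose D : set R := `[4^-1, 1]%classic.
have mD : measurable (D : set (measurableTypeR R)) by exact: measurable_itv.
apply: (@lt_le_trans _ _ (\int[lebesgue_measure]_(x in D)
    (Num.sqrt (w_dissip x))%:E)%E); last first.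
  by apply: ge0_subset_integral => //; exact: msqrt.
apply: (@lt_le_trans _ _ (\int[lebesgue_measure]_(x in D) (cst (2^-1)%:E x))%E).
  have h : (4^-1 : R) < 1 by lra.
  rewrite integral_cst// [X in (_ * X)%E](_ : _ = (1 - 4^-1)%:E); last exact: leb.
  by rewrite -EFinM lte_fin mulr_gt0// subr_gt0.
apply: ge0_le_integral => //=.
- exact: msqrt.
- move=> s; rewrite /D /= in_itv /= => /andP[s0 s1].
  rewrite lee_fin /w_dissip (_ : 2^-1 = Num.sqrt (4^-1 : R)); first by rewrite ler_sqrt; lra.
  by rewrite (_ : 4^-1 = 2^-1 ^+ 2 :> R) ?sqrtr_sqr ?ger0_norm//; lra.
Qed.

End dissipation_constant.

(** * Affine functions in coordinates *)

Section affine_functions.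
Variables (R : realType) (n : nat).
Notation V := 'rV[R]_n.+1.

(** [affine] asks for a bundled linear map; it is built here from the plain linearity equation. *)
Lemma affine_of (W : lmodType R) (f L : V -> W) (b : W) :
  (forall s x y, L (s *: x + y) = s *: L x + L y) -> (forall x, f x = b + L x) ->
  affine f.
Proof.
move=> Ll fE.
pose lL : {linear V -> W} := HB.pack L (GRing.isLinear.Build _ _ _ _ L Ll).
by exists lL, b.
Qed.

Lemma affineE (f : V -> R) : affine f ->
  exists w : 'cV[R]_n.+1, forall x, f x = f 0 + (x *m w) ord0 ord0.
Proof.
move=> [L [b fE]]; exists (\col_i L (delta_mx ord0 i)) => x.
rewrite !fE linear0 addr0 [in LHS](row_sum_delta x) linear_sum mxE; congr (_ + _).
by apply: eq_bigr => i _; rewrite linearZ mxE.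
Qed.

Lemma affineP (f : V -> R) (c : R) (w : 'cV[R]_n.+1) :
  (forall x, f x = c + (x *m w) ord0 ord0) -> affine f.
Proof.
move=> fE; apply: (affine_of (L := fun x => (x *m w) ord0 ord0) (b := c)) => //.
by move=> s x y; rewrite mulmxDl -scalemxAl !mxE.
Qed.

Lemma affine_continuous (f : V -> R) : affine f -> continuous f.
Proof.
move=> /affineE[w fE]; rewrite (funext fE).
apply: continuous_addR; first exact: continuous_cst.
have := @continuous_mulmx_coord R n.+1 1 0 w ord0.
by under eq_fun do rewrite subr0.
Qed.

Lemma affine_lin (f g : V -> R) s : affine f -> affine g ->
  affine (fun x => s * f x + g x).
Proof.
move=> /affineE[w fE] /affineE[w' gE].
apply: (affineP (c := s * f 0 + g 0) (w := s *: w + w')) => x.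
by rewrite fE gE mulmxDr -scalemxAr !mxE; ring.
Qed.

Lemma affine_comp (u : V -> V) i : affine u -> affine (Defs.comp u i).
Proof.
move=> [L [b uE]]; apply: (affine_of (L := fun x => L x ord0 i) (b := b ord0 i)).
  by move=> s x y; rewrite linearP !mxE.
by move=> x; rewrite /Defs.comp uE mxE.
Qed.

End affine_functions.

(** * Partial derivatives of affine functions *)

Section derivatives.
Variables (R : realType) (n : nat).
Notation V := 'rV[R]_n.+1.

Lemma pderiv_affine (f : V -> R) (w : 'cV[R]_n.+1) i x :
  (forall x, f x = f 0 + (x *m w) ord0 ord0) -> pderiv i f x = w i ord0.
Proof.
move=> fE; rewrite /pderiv /derive; apply/cvg_lim => //.
(* The difference quotient of an affine function is the same for all [h != 0]. *)
apply: cvg_near_cst; near=> h; rewrite /= fE (fE x).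
have h0 : h != 0 by near: h; exact: nbhs_dnbhs_neq.
rewrite mulmxDl !mxE (bigD1 i)//= big1 ?addr0 => [|j ji].
  rewrite !mxE !eqxx /= mulr1 [X in X - _]addrCA addrK.
  by rewrite [LHS]mulrA mulVf// mul1r.
by rewrite !mxE (negbTE ji) andbF mulr0 mul0r.
Unshelve. all: by end_near. Qed.

End derivatives.

(** * Linearity and definiteness of the discrete forms *)

Section forms_bilinear.
Variables (R : realType) (n : nat) (M : simplicial_mesh R n).
Notation V := 'rV[R]_n.+1.
Implicit Types (a b : broken M R) (u : broken M V) (g : broken M R).

Lemma P1_continuous a k : P1 a -> continuous (a k).
Proof. by move=> Pa; apply: affine_continuous. Qed.

Lemma P1_lin a b s : P1 a -> P1 b -> P1 (fun k x => s * a k x + b k x).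
Proof. by move=> Pa Pb k; exact: affine_lin. Qed.

Lemma grad_h_affine a k : P1 a ->
  exists2 w : 'cV[R]_n.+1, forall x, a k x = a k 0 + (x *m w) ord0 ord0 &
    forall x, grad_h a k x = w^T.
Proof.
move=> /(_ k)/affineE[w aE]; exists w => // x.
by apply/rowP => i; rewrite !mxE (pderiv_affine _ _ aE).
Qed.

Lemma grad_h_cst a k x : P1 a -> grad_h a k x = grad_h a k 0.
Proof. by move=> /grad_h_affine -/(_ k)[w _ gE]; rewrite !gE. Qed.

Lemma grad_h_lin a b s k x : P1 a -> P1 b ->
  grad_h (fun k x => s * a k x + b k x) k x = s *: grad_h a k x + grad_h b k x.
Proof.
move=> Pa Pb; have [w aE ->] := grad_h_affine k Pa.
have [w' bE ->] := grad_h_affine k Pb.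
apply/rowP => i; rewrite !mxE; rewrite (pderiv_affine (w := s *: w + w')) ?mxE// => y.
by rewrite aE bE mulmxDr -scalemxAr !mxE; ring.
Qed.

Lemma grad_h_eq0 a k : P1 a -> grad_h a k 0 = 0 -> forall x, a k x = a k 0.
Proof.
move=> Pa; have [w aE ->] := grad_h_affine k Pa => w0 x.
by rewrite aE -[w]trmxK w0 trmx0 mulmx0 mxE addr0.
Qed.

(** A displacement that is affine on a cell has constant strain there. *)
Lemma energy_density_cst (lambda mu : R) u k x : P1 u ->
  energy_density lambda mu u k x = energy_density lambda mu u k 0.
Proof.
move=> Pu; rewrite /energy_density.
suff -> : sym_grad_h u k x = sym_grad_h u k 0 by [].
have /choice[w wE] i := affineE (affine_comp i (Pu k)).
by apply/matrixP => i j; rewrite !mxE !(pderiv_affine _ _ (wE _)).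
Qed.

Lemma energy_density_ge0 (lambda mu : R) u k x : hooke_posdef n lambda mu ->
  0 <= energy_density lambda mu u k x.
Proof.
move=> hC; rewrite /energy_density.
(* [hooke_posdef] speaks of nonzero matrices, so zero strain is treated apart. *)
have [->|e0] := eqVneq (sym_grad_h u k x) 0.
  by rewrite /ddot big1// => i _; rewrite big1// => j _; rewrite [X in _ * X]mxE mulr0.
by apply/ltW/hC => //; apply/matrixP => i j; rewrite !mxE addrC.
Qed.

Lemma measurable_cell k : measurable (@cell _ _ M k).
Proof. by apply: closed_measurable_rV; exact: closed_cell. Qed.

Lemma integrable_cell k (f : V -> R) : continuous f ->
  (lebesgue_rV R n.+1).-integrable (@cell _ _ M k) (EFin \o f).
Proof.
move=> fc; apply: integrable_continuous_compact => //; first exact: compact_hull.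
exact/lebesgue_rV_compact/compact_hull.
Qed.

Lemma broken_int_lin g g' s :
  (forall k, continuous (g k)) -> (forall k, continuous (g' k)) ->
  broken_int (fun k x => s * g k x + g' k x) = s * broken_int g + broken_int g'.
Proof.
move=> gc gc'; rewrite /broken_int mulr_sumr -big_split; apply: eq_bigr => k _ /=.
rewrite RintegralD ?RintegralZl//; try exact: measurable_cell.
- exact: integrable_cell.
- apply: integrable_cell; apply: continuous_mulR => //; exact: continuous_cst.
- exact: integrable_cell.
Qed.

Lemma eq_broken_int g g' : (forall k x, g k x = g' k x) -> broken_int g = broken_int g'.
Proof. by move=> gg; congr broken_int; apply/funext => k; apply/funext => x. Qed.

Variables (lambda mu ell Gc : R) (u : broken M V).
Hypothesis Pu : P1 u.
Let Af := A_form lambda mu ell Gc u.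
Let ff := f_form lambda mu ell Gc u.

Let energy_continuous k : continuous (energy_density lambda mu u k).
Proof.
rewrite (_ : energy_density _ _ _ _ = fun=> energy_density lambda mu u k 0).
  exact: continuous_cst.
by apply/funext => x; exact: energy_density_cst.
Qed.

Let grad_continuous a b k : P1 a -> P1 b ->
  continuous (fun x => ell * dotrV (grad_h a k x) (grad_h b k x)).
Proof.
move=> Pa Pb.
rewrite (_ : (fun x => _) = fun=> ell * dotrV (grad_h a k 0) (grad_h b k 0)).
  exact: continuous_cst.
by apply/funext => x; rewrite grad_h_cst// (grad_h_cst k x Pb).
Qed.

Let EI a b := broken_int (fun k x => energy_density lambda mu u k x * a k x * b k x).
Let GI a b := broken_int (fun k x => ell * dotrV (grad_h a k x) (grad_h b k x)).

Let A_formE a b : Af a b = EI a b + 2 * Gc / c_w R * GI a b.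
Proof. by []. Qed.

Lemma A_formC a b : Af a b = Af b a.
Proof.
have EC : EI a b = EI b a by apply: eq_broken_int => k x; rewrite mulrAC.
have GC : GI a b = GI b a.
  apply: eq_broken_int => k x; congr (_ * _).
  by apply: eq_bigr => i _; rewrite mulrC.
by rewrite 2!A_formE EC GC.
Qed.

Lemma A_form_linl a a' b s : P1 a -> P1 a' -> P1 b ->
  Af (fun k x => s * a k x + a' k x) b = s * Af a b + Af a' b.
Proof.
move=> Pa Pa' Pb.
have EC (c : broken M R) k : P1 c -> continuous (fun x => energy_density lambda mu u k x * c k x * b k x).
  by move=> Pc; do ?apply: continuous_mulR => //; exact: P1_continuous.
have EL : EI (fun k x => s * a k x + a' k x) b = s * EI a b + EI a' b.
  rewrite /EI -broken_int_lin => [|k|k]; try exact: EC.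
  by apply: eq_broken_int => k x; ring.
have GL : GI (fun k x => s * a k x + a' k x) b = s * GI a b + GI a' b.
  rewrite /GI -broken_int_lin => [|k|k]; try exact: grad_continuous.
  apply: eq_broken_int => k x.
  rewrite grad_h_lin// /dotrV !mulr_sumr -big_split; apply: eq_bigr => i _.
  by rewrite /= !mxE; ring.
rewrite 3!A_formE EL GL.
by move: (EI a b) (EI a' b) (GI a b) (GI a' b) (_ / c_w R) => ? ? ? ? ?; ring.
Qed.

Let FI a := broken_int (fun k x => energy_density lambda mu u k x * a k x).
Let LI a := broken_int (fun k x => a k x / ell).

Let f_formE a : ff a = FI a - Gc / c_w R * LI a.
Proof. by []. Qed.

Lemma f_form_lin a a' s : P1 a -> P1 a' ->
  ff (fun k x => s * a k x + a' k x) = s * ff a + ff a'.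
Proof.
move=> Pa Pa'.
have FC (c : broken M R) k : P1 c -> continuous (fun x => energy_density lambda mu u k x * c k x).
  by move=> Pc; apply: continuous_mulR => //; exact: P1_continuous.
have LC (c : broken M R) k : P1 c -> continuous (fun x => c k x / ell).
  move=> Pc; apply: continuous_mulR; [exact: P1_continuous | exact: continuous_cst].
have FL : FI (fun k x => s * a k x + a' k x) = s * FI a + FI a'.
  rewrite /FI -broken_int_lin => [|k|k]; try exact: FC.
  by apply: eq_broken_int => k x; ring.
have LL : LI (fun k x => s * a k x + a' k x) = s * LI a + LI a'.
  rewrite /LI -broken_int_lin => [|k|k]; try exact: LC.
  by apply: eq_broken_int => k x; ring.
rewrite 3!f_formE FL LL.
by move: (FI a) (FI a') (LI a) (LI a') (_ / c_w R) => ? ? ? ? ?; ring.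
Qed.

(** The elastic term is nonnegative but vanishes where the strain does, so the conclusion is drawn
    from the gradient term: it is a sum over the cells of nonnegative constants times positive
    volumes, and each summand must vanish. *)
Lemma A_form_le0 a : hooke_posdef n lambda mu -> 0 < ell -> 0 < Gc -> P1 a ->
  Af a a <= 0 -> forall k x, a k x = a k 0.
Proof.
move=> hC l0 G0 Pa; rewrite A_formE => Aa0 k.
apply: grad_h_eq0 => //.
have E0 : 0 <= EI a a.
  apply: sumr_ge0 => i _; apply: Rintegral_ge0 => x _.
  by rewrite -mulrA -expr2 mulr_ge0 ?sqr_ge0// energy_density_ge0.
have c0 : 0 < 2 * Gc / c_w R by rewrite !mulr_gt0 ?invr_gt0// c_w_gt0.
have cell_gt0 i : 0 < fine (lebesgue_rV R n.+1 (@cell _ _ M i)).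
  have [p pi] := hull_interior (vertex_indep i).
  rewrite fine_gt0// (lebesgue_rV_nbhs_gt0 _ pi)//=; last exact: measurable_cell.
  exact/lebesgue_rV_compact/compact_hull.
have sq0 (v : V) : 0 <= dotrV v v.
  by apply: sumr_ge0 => i _; rewrite -expr2 sqr_ge0.
have gE : GI a a =
    \sum_i ell * dotrV (grad_h a i 0) (grad_h a i 0) *
      fine (lebesgue_rV R n.+1 (@cell _ _ M i)).
  apply: eq_bigr => i _; rewrite -Rintegral_cst; last exact: measurable_cell.
  by congr Rintegral; apply/funext => x; rewrite grad_h_cst.
have : GI a a <= 0.
  by rewrite -(pmulr_rle0 _ c0); move: Aa0 E0; lra.
rewrite gE => S0.
have t0 i : 0 <= ell * dotrV (grad_h a i 0) (grad_h a i 0) *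
    fine (lebesgue_rV R n.+1 (@cell _ _ M i)).
  by rewrite !mulr_ge0 ?sq0// ltW.
have : ell * dotrV (grad_h a k 0) (grad_h a k 0) *
    fine (lebesgue_rV R n.+1 (@cell _ _ M k)) == 0.
  rewrite eq_le t0 andbT; apply: le_trans S0.
  by rewrite (bigD1 k)//= lerDl sumr_ge0.
rewrite !mulf_eq0 (gt_eqF l0) (gt_eqF (cell_gt0 k)) orbF /=.
rewrite psumr_eq0 => [/allP h|i _]; last by rewrite -expr2 sqr_ge0.
apply/rowP => i; have := h i; rewrite mem_index_enum => /(_ isT).
by rewrite mulf_eq0 orbb => /eqP ->; rewrite mxE.
Qed.

End forms_bilinear.

(** * Affine independence and removal of a vertex *)

Section affine_independence.
Variables (R : realType) (d : nat).

Lemma affinely_independentP m (q : 'I_m.+1 -> 'rV[R]_d) :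
  affinely_independent q <->
  forall a : 'I_m.+1 -> R, \sum_j a j = 0 -> \sum_j a j *: q j = 0 -> forall j, a j = 0.
Proof.
have edgesE (a : 'I_m.+1 -> R) : \sum_j a j = 0 ->
    \sum_j a j *: q j = (\row_i a (lift ord0 i)) *m edges q.
  rewrite !big_ord_recl => /eqP; rewrite addr_eq0 => /eqP ->.
  rewrite mulmx_sum_row scaleNr scaler_suml -sumrN -big_split; apply: eq_bigr => i _.
  by rewrite mxE rowK scalerBr addrC.
split=> [qf a a0 aq|h].
  have /eqP := edgesE a a0; rewrite aq eq_sym mulmx_free_eq0// => /eqP/rowP al.
  have {}al i : a (lift ord0 i) = 0 by have := al i; rewrite !mxE.
  move=> j; case: (unliftP ord0 j) => [i ->|->]; first exact: al.
  by move: a0; rewrite big_ord_recl big1 ?addr0.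
rewrite /affinely_independent -kermx_eq0; apply/rowV0P => v /sub_kermxP vq.
pose a (j : 'I_m.+1) := if unlift ord0 j is Some i then v ord0 i else - \sum_i v ord0 i.
have a0 : a ord0 = - \sum_i v ord0 i by rewrite /a unlift_none.
have al i : a (lift ord0 i) = v ord0 i by rewrite /a liftK.
have sa : \sum_j a j = 0.
  by rewrite big_ord_recl a0 (eq_bigr _ (fun i _ => al i)) addNr.
apply/rowP => i; rewrite -al mxE; apply: h => //.
rewrite edgesE// (_ : \row_i _ = v) ?vq//.
by apply/rowP => k; rewrite mxE al.
Qed.

Lemma affinely_independent_lift m (q : 'I_m.+2 -> 'rV[R]_d) (i : 'I_m.+2) :
  affinely_independent q -> affinely_independent (fun j : 'I_m.+1 => q (lift i j)).
Proof.
move=> /affinely_independentP qf; apply/affinely_independentP => a a0 aq j.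
pose b (j : 'I_m.+2) := if unlift i j is Some k then a k else 0.
have bi : b i = 0 by rewrite /b unlift_none.
have bl k : b (lift i k) = a k by rewrite /b liftK.
rewrite -bl; apply: qf; rewrite (bigD1_ord i)//= bi ?scale0r add0r.
  by rewrite (eq_bigr _ (fun k _ => bl k)).
by rewrite (eq_bigr (fun k => a k *: q (lift i k))) => [|k _]; rewrite ?bl.
Qed.

End affine_independence.

(** * The Crouzeix-Raviart space and its coordinates *)

Section discrete_space.
Variables (R : realType) (n : nat) (M : simplicial_mesh R n).
Notation V := 'rV[R]_n.+1.
Implicit Types (a b : broken M R) (F : facet_idx M).

Lemma facet_measure_fin F (A : set V) : measurable A -> (facet_measure F A < +oo)%E.
Proof. exact: simplex_measure_fin. Qed.

(** The vertices of a facet are still affinely independent, so its Gram factor is positive. *)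
Lemma facet_measure_gt0 F : (0 < facet_measure F (facet F))%E.
Proof.
apply: simplex_measure_hull_gt0.
  exact/affinely_independent_lift/vertex_indep.
move=> x [b [b0 _ b1 ->]].
exists (fun j => if unlift F.2 j is Some k then b k else 0); split.
- by move=> j; case: unlift.
- by move=> j; rewrite !inE negbK => /eqP ->; rewrite unlift_none.
- rewrite (bigD1_ord F.2)//= unlift_none add0r -[RHS]b1.
  by apply: eq_bigr => k _; rewrite liftK.
- rewrite [RHS](bigD1_ord F.2)//= unlift_none scale0r add0r.
  by apply: eq_bigr => k _; rewrite liftK.
Qed.

Lemma measurable_facet F : measurable (facet F).
Proof. by apply: compact_measurable_rV; exact: compact_hull. Qed.

Lemma integrable_facet F (f : V -> R) : continuous f ->
  (facet_measure F).-integrable (facet F) (EFin \o f).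
Proof.
move=> fc; apply: integrable_continuous_compact => //; first exact: compact_hull.
apply: facet_measure_fin; exact: measurable_facet.
Qed.

Variables Omega dD : set V.

Lemma A_space0 : A_space Omega dD (fun (_ : 'I_(ncells M)) _ => 0 : R).
Proof.
split.
- by move=> k; apply: (affineP (c := 0) (w := 0)) => x; rewrite mulmx0 mxE addr0.
- move=> F F' _ _; under eq_Rintegral do rewrite subr0.
  by rewrite Rintegral_cst ?mul0r//; exact: measurable_facet.
- by move=> F _; exact: aeW.
Qed.

Lemma A_space_lin a b s : A_space Omega dD a -> A_space Omega dD b ->
  A_space Omega dD (fun k x => s * a k x + b k x).
Proof.
move=> [Pa Ja Da] [Pb Jb Db]; split; first exact: P1_lin.
- move=> F F' FF' fF.
  have cJ (c : broken M R) : P1 c -> continuous (fun x => c F.1 x - c F'.1 x).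
    move=> Pc; apply: continuous_addR; first exact: P1_continuous.
    by move=> x; exact: (cvgN (@P1_continuous _ _ _ c F'.1 Pc x)).
  rewrite (_ : (fun x => _) = fun x => s * (a F.1 x - a F'.1 x) + (b F.1 x - b F'.1 x)).
    rewrite RintegralD ?RintegralZl ?Ja ?Jb ?mulr0 ?addr0//; try exact: measurable_facet.
    - by apply: integrable_facet; exact: cJ.
    - apply: integrable_facet; apply: continuous_mulR; [exact: continuous_cst | exact: cJ].
    - by apply: integrable_facet; exact: cJ.
  by apply/funext => x; ring.
- move=> F bF; move: (Da F bF) (Db F bF); apply: filterS2 => x ax bx Dx.
  by rewrite ax// bx// mulr0 addr0.
Qed.

Lemma A_space_constant a : polyhedral_domain Omega -> fits M Omega -> closed dD ->
  (0 < surface M Omega dD)%E -> A_space Omega dD a ->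
  (forall k x, a k x = a k 0) -> forall k x, a k x = 0.
Proof.
move=> [oO cO _ _] hM cD D0 [Pa Ja Da] ca k x.
(* The surface measure is a finite sum over the boundary facets, so one term is positive on [dD]. *)
have [F bF FD] : exists2 F : facet_idx M, boundary_facet Omega F & (0 < facet_measure F dD)%E.
  apply: contrapT => /forall2NP nF; move: D0; rewrite /surface big1 ?ltxx// => F /asboolP bF.
  have [//|] := nF F; move=> /negP; rewrite -leNgt => F0.
  by apply/eqP; rewrite eq_le F0 measure_ge0.
(* Were this constant nonzero, the null set where the Dirichlet condition fails would contain
   [dD]. *)
have aF : a F.1 0 = 0.
  apply: contrapT => aF0; move: FD; rewrite measure_negligible ?ltxx//.
    exact: closed_measurable_rV.
  by apply: negligibleS (Da F bF) => y Dy /(_ Dy); rewrite ca.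
rewrite ca.
(* The property passed from cell to cell is the vanishing of the constant. *)
have := @facet_connected R n M Omega (fun k => a k 0 == 0) oO cO hM _ F.1 k.
rewrite aF eqxx => h; apply/eqP/h => // {h k aF bF FD} {F} F F' FF' fF.
have := Ja F F' FF' fF; under eq_Rintegral do rewrite ca (ca F'.1).
rewrite Rintegral_cst; last exact: measurable_facet.
(* The integral of a constant jump is the jump times the area of the facet, which is finite and
   positive. *)
move=> /eqP; rewrite mulf_eq0 subr_eq0 => /orP[/eqP <-//|/eqP f0].
have := facet_measure_gt0 F; rewrite -[X in (_ < X)%E]fineK ?f0 ?ltxx//.
rewrite ge0_fin_numE//; apply: facet_measure_fin; exact: measurable_facet.
Qed.

(** One vector encodes the whole mesh: [vec_mx] gives one row per cell, with the value at the origin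
    in column 0 and the slopes in the others. *)
Definition of_coeffs (c : 'rV[R]_(ncells M * n.+2)) : broken M R :=
  fun k x => vec_mx c k ord0 + \sum_i x ord0 i * vec_mx c k (lift ord0 i).

Lemma of_coeffs_lin s c c' k x :
  of_coeffs (s *: c + c') k x = s * of_coeffs c k x + of_coeffs c' k x.
Proof.
rewrite /of_coeffs linearP !mxE mulrDr mulr_sumr addrACA -big_split; congr (_ + _).
by apply: eq_bigr => i _; rewrite !mxE /=; ring.
Qed.

Lemma P1_of_coeffs a : P1 a -> exists c, a = of_coeffs c.
Proof.
move=> Pa; have /choice[w wE] k := affineE (Pa k).
exists (mxvec (\matrix_(k, j) if unlift ord0 j is Some i then w k i ord0 else a k 0)).
apply/funext => k; apply/funext => x; rewrite wE /of_coeffs mxvecK !mxE unlift_none.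
by congr (_ + _); apply: eq_bigr => i _; rewrite mxE liftK.
Qed.

(** The coefficients are read off at the origin and at the unit vectors, which may lie outside the
    cell since the affine functions live on the whole space. *)
Lemma of_coeffs_inj c : (forall k x, of_coeffs c k x = 0) -> c = 0.
Proof.
move=> c0; rewrite -[c]vec_mxK; apply/eqP; rewrite mxvec_eq0; apply/eqP/matrixP => k j.
have k0 : vec_mx c k ord0 = 0.
  rewrite -[RHS](c0 k 0) /of_coeffs big1 ?addr0// => i _.
  by rewrite mxE mul0r.
rewrite [RHS]mxE; case: (unliftP ord0 j) => [i ->|->//].
rewrite -[RHS](c0 k (delta_mx ord0 i)) /of_coeffs k0 add0r (bigD1 i)//= big1 => [|l li].
  by rewrite [X in X * _]mxE !eqxx mul1r addr0.
by rewrite [X in X * _]mxE (negbTE li) andbF mul0r.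
Qed.

(** A linear isomorphism with a coordinate space, where compactness arguments apply; the rows of [A]
    form a basis of the coefficient vectors. *)
Lemma A_space_parametrization : exists m (psi : 'rV[R]_m -> broken M R),
  [/\ forall s y z k x, psi (s *: y + z) k x = s * psi y k x + psi z k x,
      forall y, A_space Omega dD (psi y),
      forall a, A_space Omega dD a -> exists y, a = psi y
    & forall y, (forall k x, psi y k x = 0) -> y = 0].
Proof.
pose W c := A_space Omega dD (of_coeffs c).
have [||m [A [fA WA]]] := @subspace_row_space R _ W.
- rewrite /W (_ : of_coeffs 0 = fun _ _ => 0); first exact: A_space0.
  apply/funext => k; apply/funext => x; have := of_coeffs_lin (- 1) 0 0 k x.
  by rewrite scaler0 addr0 mulN1r addNr.
- move=> s c c' Wc Wc'; rewrite /W (_ : of_coeffs _ =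
    fun k x => s * of_coeffs c k x + of_coeffs c' k x); first exact: A_space_lin.
  by apply/funext => k; apply/funext => x; exact: of_coeffs_lin.
exists m, (fun y => of_coeffs (y *m A)); split.
- by move=> s y z k x; rewrite mulmxDl -scalemxAl of_coeffs_lin.
- by move=> y; apply/WA; exists y.
- move=> a Aa; have [c ac] := P1_of_coeffs (let: And3 h _ _ := Aa in h).
  by have [|y yc] := (WA c).1; [rewrite /W -ac | exists y; rewrite -yc].
- by move=> y /of_coeffs_inj/eqP; rewrite mulmx_free_eq0// => /eqP.
Qed.

End discrete_space.

(** * Existence and uniqueness for the constrained problem *)

Theorem proposition2 (R : realType) (n : nat)
    (hd : (n.+1 = 2)%N \/ (n.+1 = 3)%N)
    (Omega : set 'rV[R]_n.+1) (hOmega : polyhedral_domain Omega)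
    (M : simplicial_mesh R n) (hM : fits M Omega)
    (dD dN : set 'rV[R]_n.+1) (hpart : boundary_partition M Omega dD dN)
    (lambda mu : R) (hC : hooke_posdef n lambda mu)
    (ell Gc : R) (hell : 0 < ell) (hGc : 0 < Gc)
    (w f : 'rV[R]_n.+1 -> 'rV[R]_n.+1)
    (hw : H12_vec M Omega w)
    (hf : H1_vec Omega f) (hfw : trace_eq M Omega dD f w)
    (u : broken M 'rV[R]_n.+1) (hu : U_space Omega dD f u)
    (alpha0 : broken M R) (halpha0 : A_space Omega dD alpha0) :
  exists! alpha : broken M R,
    K_set Omega dD alpha0 alpha /\
    forall beta : broken M R, K_set Omega dD alpha0 beta ->
      A_form lambda mu ell Gc u alpha (fun k x => beta k x - alpha k x) >=
      f_form lambda mu ell Gc u (fun k x => beta k x - alpha k x).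
Proof.
have Pu : P1 u by have [] := hu.
have [_ _ cD D0 _] := hpart.
have Af_lin := A_form_linl lambda mu ell Gc Pu.
have Af_C := @A_formC R n M lambda mu ell Gc u.
have ff_lin := f_form_lin lambda mu ell Gc Pu.
have Af_pos := @A_form_le0 R n M lambda mu ell Gc u.
(* Otherwise unification unfolds the integrals and does not terminate in practice. *)
move: (A_form lambda mu ell Gc u) (f_form lambda mu ell Gc u) Af_lin Af_C ff_lin Af_pos.
move=> Af ff Af_lin Af_C ff_lin Af_pos.
have definite (a : broken M R) : A_space Omega dD a -> Af a a <= 0 -> forall k x, a k x = 0.
  move=> Aa aa0; apply: (A_space_constant hOmega hM cD D0 Aa).
  by apply: Af_pos => //; case: Aa.
have [m [psi [psi_lin psiA psi_onto psi_inj]]] := A_space_parametrization M Omega dD.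
have psi_linE s y z : psi (s *: y + z) = fun k x => s * psi y k x + psi z k x.
  by apply/funext => k; apply/funext => x; exact: psi_lin.
have psiP y : P1 (psi y) by have [] := psiA y.
(* Membership of [psi y] in the discrete space is automatic, so only the obstacle condition remains;
   the coordinates of [alpha0] satisfy it. *)
pose K := [set y | forall k x, cell k x -> alpha0 k x <= psi y k x].
have [y0 ay0] := psi_onto _ halpha0.
have [|||||||y Ky yK] := @variational_inequality R m (fun y z => Af (psi y) (psi z))
    (fun y => ff (psi y)) _ _ _ _ K y0.
- by move=> s x y z; rewrite psi_linE Af_lin.
- by move=> x y; rewrite Af_C.
- move=> y y_neq0; rewrite ltNge; apply: contra_neqN y_neq0 => h.
  by apply: psi_inj; apply: definite.
- by move=> s x y; rewrite psi_linE ff_lin.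
(* At a fixed point of a cell the value is linear in [y], so [K] is an intersection of closed
   sets. *)
- rewrite (_ : K = \bigcap_(k in [set: 'I_(ncells M)]) \bigcap_(x in cell k)
      ((fun y => psi y k x) @^-1` [set r | alpha0 k x <= r])).
    apply: closed_bigI => k _; apply: closed_bigI => x _.
    apply: closed_comp; last exact: closed_ge.
    by move=> y _; apply: continuous_scalar_rV => s y' z; exact: psi_lin.
  by apply/seteqP; split=> y Ky k; [move=> _|]; move=> x kx; apply: Ky.
- by move=> k x _; rewrite ay0.
- move=> t x y /andP[t0 t1] Kx Ky k z kz; rewrite -[y - x]scale1r.
  have := Kx k z kz; have := Ky k z kz => hy hx.
  rewrite psi_lin scale1r -[y - x]addrC -scaleN1r psi_lin.
  (* The gap above the obstacle at the combined point is the convex combination of the two gaps. *)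
  have : 0 <= t * (psi y k z - alpha0 k z) + (1 - t) * (psi x k z - alpha0 k z).
    by rewrite addr_ge0// mulr_ge0// subr_ge0.
  lra.
have psiB x z : (fun k t => psi z k t - psi x k t) = psi (z - x).
  by rewrite addrC -scaleN1r psi_linE; apply/funext => k; apply/funext => t; ring.
exists (psi y); split.
  split; first by split.
  by move=> b [/psi_onto[z ->] zK]; rewrite psiB; exact: yK.
(* Uniqueness: each of the two solutions is tested against the other, and the sum of the
   inequalities makes the form nonpositive at their difference. *)
move=> a' [[/psi_onto[z ->] Kz] zK].
have hz := yK z Kz.
have := zK (psi y) (conj (psiA y) Ky); rewrite psiB => hy.
have F0 : ff (psi 0) = 0.
  by have := ff_lin _ _ (-1) (psiP 0) (psiP 0); rewrite -psi_linE scaler0 addr0; lra.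
have B0 x : Af (psi 0) (psi x) = 0.
  have := Af_lin _ _ _ (-1) (psiP 0) (psiP 0) (psiP x).
  by rewrite -psi_linE scaler0 addr0; lra.
(* This shape lets the linearity lemmas apply, with [F0] and [B0] removing the zero term. *)
have yz : y - z = -1 *: (z - y) + 0 by rewrite scaleN1r opprB addr0.
move: hy; rewrite yz psi_linE ff_lin// F0 Af_C Af_lin// B0 Af_C => hy.
have zy : z = 1 *: (z - y) + y by rewrite scale1r subrK.
have : Af (psi z) (psi (z - y)) = Af (psi (z - y)) (psi (z - y)) + Af (psi y) (psi (z - y)).
  by rewrite {1}zy psi_linE Af_lin// mul1r.
move=> zE; suff /psi_inj/eqP : forall k x, psi (z - y) k x = 0.
  by rewrite subr_eq0 => /eqP ->.
by apply: definite => //; lra.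
Qed.
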